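(* Let $H\subset\mathbb{R}^N$ be an open affine half space, let $Q:\mathbb{R}^N\to\mathbb{R}^N$ be the reflection at $\partial H$, and write $\bar x=Q(x)$. Let $J:\mathbb{R}^N\setminus\{0\}\to[0,\infty)$ be a measurable, even function ($J(-z)=J(z)$) such that $(J1)$ $\int_{\mathbb{R}^N\setminus B_1(0)}J(z)\,dz+\int_{B_1(0)}|z|^2J(z)\,dz<\infty$ and $\int_{\mathbb{R}^N}J(z)\,dz=\infty$; $J(\bar x-\bar y)=J(x-y)$ for all $x,y\in\mathbb{R}^N$ with $x\ne y$; $J(x-y)\ge J(x-\bar y)$ for all $x,y\in H$ with $x\neq y$. Let $U\subset H$ be an open bounded set and let $c\in L^\infty(U)$ with $\|c^+\|_{L^\infty(U)}<\Lambda_1(U)$. Then every antisymmetric supersolution $v$ of the problem $$Iv=c(x)v\ \text{ in }U,\qquad v\equiv0\ \text{ on }H\setminus U$$ satisfies $v\ge0$ a.e. in $H$.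
   Context: Functions are identified when they agree almost everywhere. Positive part: $c^+=\max\{c,0\}$. Put $$\mathcal{J}(u,v)=\frac12\int_{\mathbb{R}^N}\int_{\mathbb{R}^N}(u(x)-u(y))(v(x)-v(y))J(x-y)\,dx\,dy.$$ For open $U\subset\mathbb{R}^N$, $\mathcal{D}(U)=\{u:\mathbb{R}^N\to\mathbb{R}\text{ measurable}:\mathcal{J}(u,u)<\infty,\ u\equiv0\text{ on }\mathbb{R}^N\setminus U\}$; for bounded open $U$ one has $\mathcal{D}(U)\subset L^2(\mathbb{R}^N)$, and $$\Lambda_1(U)=\inf_{u\in\mathcal{D}(U),\,u\not\equiv0}\frac{\mathcal{J}(u,u)}{\|u\|_{L^2(U)}^2}.$$ For measurable $U'\subset\mathbb{R}^N$, $\mathcal{H}(U')$ is the space of all $v\in L^2(\mathbb{R}^N)$ with $\int_{U'}\int_{U'}(v(x)-v(y))^2J(x-y)\,dx\,dy<\infty$. A function $v:\mathbb{R}^N\to\mathbb{R}$ is antisymmetric if $v(\bar x)=-v(x)$ for $x\in\mathbb{R}^N$. For an open bounded set $U\subset H$ and $c\in L^\infty(U)$, an antisymmetric function $v:\mathbb{R}^N\to\mathbb{R}$ is called an antisymmetric supersolution of the problem $Iv=c(x)v$ in $U$, $v\equiv0$ on $H\setminus U$, if $v\in\mathcal{H}(U')$ for some open bounded set $U'\subset\mathbb{R}^N$ with $Q(U')=U'$ and $\overline U\subset U'$, $v\ge0$ on $H\setminus U$, and $$\mathcal{J}(v,\varphi)\ge\int_Uc(x)v(x)\varphi(x)\,dx\qquad\text{for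 all }\varphi\in\mathcal{D}(U),\ \varphi\ge0.$$ (The double integral defining $\mathcal{J}(v,\varphi)$ converges absolutely for such $v$ and $\varphi$.) *)

(* Defs.v *)
From HB Require Import structures.
From mathcomp Require Import all_boot all_order all_algebra.
From mathcomp Require Import all_classical all_reals all_analysis.

Set Implicit Arguments.
Unset Strict Implicit.
Unset Printing Implicit Defensive.

Import Order.TTheory GRing.Theory Num.Theory.
Import numFieldNormedType.Exports.

Local Open Scope classical_set_scope.
Local Open Scope ring_scope.

Section measurable_rV.
Context {R : realType} {n : nat}.

(* The sigma-algebra generated by the coordinates, i.e. the Borel one. *)
Definition measurable_rV : set (set 'rV[R]_n) :=
  g_sigma_preimage (fun (i : 'I_n) (v : 'rV[R]_n) => v ord0 i).

Let measurable_rV0 : measurable_rV set0.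
Proof. exact: sigma_algebra0. Qed.

Let measurable_rVC A : measurable_rV A -> measurable_rV (~` A).
Proof. exact: sigma_algebraC. Qed.

Let measurable_rV_bigcup (F : (set 'rV[R]_n)^nat) :
  (forall i, measurable_rV (F i)) -> measurable_rV (\bigcup_i F i).
Proof. exact: sigma_algebra_bigcup. Qed.

HB.instance Definition _ := @isMeasurable.Build default_measure_display
  'rV[R]_n measurable_rV measurable_rV0 measurable_rVC measurable_rV_bigcup.

Lemma measurable_coord (i : 'I_n) :
  measurable_fun [set: 'rV[R]_n] (fun v : 'rV[R]_n => v ord0 i).
Proof.
move=> _ Y mY; rewrite setTI; apply: sub_sigma_algebra => /=.
rewrite -bigcup_seq/=; exists i => /=; first by rewrite mem_index_enum.
by exists Y => //; rewrite setTI.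
Qed.

Lemma measurable_fun_rVP d (T : measurableType d) (f : T -> 'rV[R]_n) :
  measurable_fun [set: T] f <->
  forall i, measurable_fun [set: T] (fun x => f x ord0 i).
Proof.
split=> [mf i|mf].
  exact: (measurableT_comp (measurable_coord i) mf).
apply: measurability => //.
move=> _ [B + <-]; rewrite -bigcup_seq => -[i _ [A mA <-]].
by rewrite !setTI -[X in measurable X]setTI; exact: mf.
Qed.

End measurable_rV.

Section lebesgue_rV.
Context {R : realType}.

Definition cons_rV n (p : R * 'rV[R]_n) : 'rV[R]_n.+1 :=
  \row_i oapp (fun j => p.2 ord0 j) p.1 (unlift ord0 i).

Definition behead_rV n (v : 'rV[R]_n.+1) : 'rV[R]_n :=
  \row_j v ord0 (lift ord0 j).

Lemma measurable_cons_rV n : measurable_fun setT (@cons_rV n).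
Proof.
apply/measurable_fun_rVP => i; under eq_fun do rewrite mxE.
case: unliftP => [j _|_] /=; last exact: measurable_fst.
exact: (measurableT_comp (measurable_coord j) measurable_snd).
Qed.

Lemma measurable_behead_rV n : measurable_fun setT (@behead_rV n).
Proof.
apply/measurable_fun_rVP => i; under eq_fun do rewrite mxE.
exact: measurable_coord.
Qed.

Lemma head_cons_rV n (p : R * 'rV[R]_n) : cons_rV p ord0 ord0 = p.1.
Proof. by rewrite mxE unlift_none. Qed.

Lemma cons_rVK n (p : R * 'rV[R]_n) : behead_rV (cons_rV p) = p.2.
Proof. by apply/rowP => j; rewrite !mxE liftK. Qed.

Section step.
Local Open Scope ereal_scope.
Context n (nu : {sigma_finite_measure set 'rV[R]_n -> \bar R}).

Definition lebesgue_rVS : set 'rV[R]_n.+1 -> \bar R :=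
  pushforward (lebesgue_measure \x nu) (@cons_rV n).

Let mfun :=
  measure_function_pushforward__canonical__measure_function_Measure
    (lebesgue_measure \x nu) (@measurable_cons_rV n).

Let lebesgue_rVS0 : lebesgue_rVS set0 = 0.
Proof. exact: (measure0 mfun). Qed.

Let lebesgue_rVS_ge0 A : 0 <= lebesgue_rVS A.
Proof. exact: (measure_ge0 mfun). Qed.

Let lebesgue_rVS_sigma_additive : semi_sigma_additive lebesgue_rVS.
Proof. exact: (@measure_semi_sigma_additive _ _ _ mfun). Qed.

HB.instance Definition _ := isMeasure.Build _ _ _ lebesgue_rVS
  lebesgue_rVS0 lebesgue_rVS_ge0 lebesgue_rVS_sigma_additive.

Let lebesgue_rVS_sigma_finite : sigma_finite setT lebesgue_rVS.
Proof.
have /sigma_finiteP[F [TF ndF Foo]] := sigma_finiteT (@lebesgue_measure R).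
have /sigma_finiteP[G [TG ndG Goo]] := sigma_finiteT nu.
pose head_rV (v : 'rV[R]_n.+1) := v ord0 ord0.
exists (fun k => head_rV @^-1` F k `&` @behead_rV n @^-1` G k).
  apply/seteqP; split=> // v _.
  have [i _ Fi] : (\bigcup_i F i) (head_rV v) by rewrite -TF.
  have [j _ Gj] : (\bigcup_i G i) (behead_rV v) by rewrite -TG.
  exists (maxn i j) => //; split => /=.
    by move: Fi; exact/subsetPset/ndF/leq_maxl.
  by move: Gj; exact/subsetPset/ndG/leq_maxr.
move=> k; have [mF Fk] := Foo k; have [mG Gk] := Goo k; split.
  apply: measurableI; rewrite -[X in measurable X]setTI.
    exact: measurable_coord.
  exact: measurable_behead_rV.
rewrite /lebesgue_rVS /pushforward (_ : _ @^-1` _ = F k `*` G k).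
  by rewrite product_measure1E// lte_mul_pinfty// ge0_fin_numE.
by apply/seteqP; split => p; rewrite /= /head_rV head_cons_rV cons_rVK.
Qed.

HB.instance Definition _ := Measure_isSigmaFinite.Build _ _ _ lebesgue_rVS
  lebesgue_rVS_sigma_finite.

End step.

Fixpoint lebesgue_rV n : {sigma_finite_measure set 'rV[R]_n -> \bar R} :=
  if n is m.+1 then lebesgue_rVS (lebesgue_rV m) else \d_(0 : 'rV[R]_0).

Lemma lebesgue_rV_box n (A : 'I_n -> set R) :
  (forall i, measurable (A i)) ->
  lebesgue_rV n [set v | forall i, A i (v ord0 i)] =
  (\prod_(i < n) lebesgue_measure (A i))%E.
Proof.
elim: n A => [|n ih] A mA /=.
  by rewrite big_ord0 diracE mem_set//= => -[].
rewrite big_ord_recl -ih// /lebesgue_rVS /pushforward -product_measure1E//.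
  congr (_ _); apply/seteqP; split => -[x v] /= xv.
    split; first by have := xv ord0; rewrite head_cons_rV.
    by move=> i; have := xv (lift ord0 i); rewrite mxE liftK.
  move=> i; rewrite mxE; case: unliftP => [j ->|->] /=; last exact: xv.1.
  exact: xv.2.
  exact: mA.
rewrite (_ : (fun _ => _) = \bigcap_(i in setT)
    ((fun v : 'rV[R]_n => v ord0 i) @^-1` A (lift ord0 i))).
  apply: fin_bigcap_measurable => // i _.
  by rewrite -[X in measurable X]setTI; exact: measurable_coord.
by apply/seteqP; split => v /= Av i; [move=> _|]; exact: Av.
Qed.

End lebesgue_rV.

Section euclidean.
Context {R : realType} {N : nat}.
Implicit Types (x y e : 'rV[R]_N) (b : R).

Definition dotrV x y : R := \sum_(i < N) x ord0 i * y ord0 i.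

(* The norm `|x| of the library on 'rV[R]_N is the sup norm. *)
Definition enorm x : R := Num.sqrt (dotrV x x).

Definition half_space e b : set 'rV[R]_N := [set x | b < dotrV e x].

Definition reflection e b x : 'rV[R]_N :=
  x - (2 * (dotrV e x - b) / dotrV e e) *: e.

End euclidean.

Section nonlocal.
Context {R : realType} {N : nat}.
Local Notation rV := 'rV[R]_N.
Local Notation mu := (@lebesgue_rV R N).
Implicit Types (J u v c : rV -> R) (U : set rV).

(* Measurability with respect to the completed (Lebesgue) sigma-algebra; the
   integral of the library is unchanged by modifications on null sets. *)
Definition lebesgue_measurable u : Prop :=
  exists2 g : rV -> R, measurable_fun setT g & {ae mu, forall x, u x = g x}.

Definition energy J u v : \bar R :=
  ((2^-1)%:E *
   \int[mu]_x \int[mu]_y ((u x - u y) * (v x - v y) * J (x - y))%:E)%E.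

Definition D_space J U : set (rV -> R) :=
  [set u | [/\ lebesgue_measurable u, (energy J u u < +oo)%E &
               {ae mu, forall x, ~ U x -> u x = 0}]].

Definition Lambda1 J U : \bar R :=
  ereal_inf [set (energy J u u / \int[mu]_(x in U) (u x ^+ 2)%:E)%E | u in
    [set u | D_space J U u /\ ~ {ae mu, forall x, u x = 0}]].

Definition L2_space : set (rV -> R) :=
  [set v | lebesgue_measurable v /\ (\int[mu]_x (v x ^+ 2)%:E < +oo)%E].

Definition H_space J U : set (rV -> R) :=
  [set v | L2_space v /\
    (\int[mu]_(x in U) \int[mu]_(y in U)
       ((v x - v y) ^+ 2 * J (x - y))%:E < +oo)%E].

Definition Linfty_norm U c : \bar R := 'N[mu]_(+oo)[EFin \o (c \_ U)]%E.

Definition Linfty_space U : set (rV -> R) :=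
  [set c | lebesgue_measurable (c \_ U) /\ (Linfty_norm U c < +oo)%E].

(* Antisymmetric supersolutions of I v = c v in U, v = 0 on H \ U, where
   H = half_space e b. *)
Definition antisymmetric_supersolution J e b U c v : Prop :=
  [/\ {ae mu, forall x, v (reflection e b x) = - v x},
      exists U' : set rV,
        [/\ open U', bounded_set U', reflection e b @` U' = U',
            closure U `<=` U' & H_space J U' v],
      {ae mu, forall x, (half_space e b `\` U) x -> 0 <= v x} &
      forall phi, D_space J U phi -> {ae mu, forall x, 0 <= phi x} ->
        (\int[mu]_(x in U) (c x * v x * phi x)%:E <= energy J v phi)%E].

End nonlocal.

(* Main.v *)
Require Import Defs.
From mathcomp Require Import all_boot all_order all_algebra.
From mathcomp Require Import all_classical all_reals all_analysis.
From mathcomp Require Import measurable_realfun ess_sup_inf simple_functions.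
From mathcomp Require Import ring lra.

Import Order.TTheory GRing.Theory Num.Theory.
Import numFieldNormedType.Exports.

Local Open Scope classical_set_scope.
Local Open Scope ring_scope.

(** The supersolution is tested with its own negative part
    phi = 1_U max(-v, 0).  Put w = v + phi, so that phi w = 0 everywhere and
    w >= 0 on the half space H.  Expanding the products gives, with
    K(x,y) = J(x-y) and S(x,y) = phi(x) w(y) K(x,y),

      (v(x)-v(y)) (phi(x)-phi(y)) K + (phi(x)-phi(y))^2 K
        = - S(x,y) - S(y,x),

    so J(v,phi) + J(phi,phi) is minus the integral of S.  The reflection Q
    preserves Lebesgue measure, hence the integral of S is half that of
    S(x,y) + S(x,Qy), and this sum is nonnegative pointwise: for y in H it is
    phi(x) times w(y) K(x,y) - v(y) K(x,Qy), where w(y) >= max(v(y), 0) and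
    K(x,y) >= K(x,Qy).  Therefore

      J(phi,phi) <= - J(v,phi) <= - int_U c v phi = int_U c phi^2
                 <= ||c^+|| ||phi||^2 < Lambda_1(U) ||phi||^2

    unless phi = 0, and the definition of Lambda_1 leaves only phi = 0.

    This computation needs absolute convergence, and phi must be shown to be
    an admissible test function.  Both follow from one pointwise majorant
    ([S_le], [P_le]).  Take x in U.  If y lies in U', then either
    (v(x)-v(y))^2 K(x,y) or its reflected analogue (v(x)-v(Qy))^2 K(x,Qy)
    dominates; the second is needed when y is outside H and v(y) < 0.  If y is
    outside U', then |x-y| is bounded below because the closure of U is a
    compact subset of the open set U', so the kernel is integrable there and
    v in L^2 is enough.

    The integral estimate [energy_cross_negpart] is proved on an abstract
    measure space with a measure preserving involution.  Three facts connect
    it to R^N.  Reflections preserve Lebesgue measure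
    ([preserves_reflection]), because a reflection is a composite of shears.
    The Lebesgue measurable data J and v have Borel representatives that keep
    their symmetries at every point ([reflected_kernel],
    [antisymmetric_representative]).  Integrals do not change when the
    integrand changes on a null set, even for non-measurable integrands
    ([ae_integral_congr]). *)

Set Implicit Arguments.
Unset Strict Implicit.
Unset Printing Implicit Defensive.

(** * Measure preserving maps *)

Lemma measurable_preimageT d1 d2 (T1 : measurableType d1)
    (T2 : measurableType d2) (f : T1 -> T2) (A : set T2) :
  measurable_fun setT f -> measurable A -> measurable (f @^-1` A).
Proof. by move=> mf mA; rewrite -[X in measurable X]setTI; exact: mf. Qed.

Section preserving.
Context {R : realType} d (T : measurableType d).

Definition preserves (m : set T -> \bar R) (f : T -> T) : Prop :=
  measurable_fun setT f /\ forall A, measurable A -> m (f @^-1` A) = m A.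

Lemma preserves_comp m f g :
  preserves m f -> preserves m g -> preserves m (f \o g).
Proof.
move=> [mf pf] [mg pg]; split; first exact: measurableT_comp.
move=> A mA; rewrite comp_preimage pg ?pf//.
exact: measurable_preimageT.
Qed.

Variable m : {measure set T -> \bar R}.

Lemma preserves_ge0_integral f (F : T -> \bar R) : preserves m f ->
  measurable_fun setT F -> (forall x, 0 <= F x)%E ->
  (\int[m]_x F (f x) = \int[m]_x F x)%E.
Proof.
move=> [mf pf] mF F0.
transitivity (\int[pushforward m f]_x F x)%E.
  by rewrite (ge0_integral_pushforward mf m measurableT)// preimage_setT.
by apply: eq_measure_integral => A mA _; exact: pf.
Qed.

Lemma preserves_integrable f (F : T -> \bar R) : preserves m f ->
  m.-integrable setT F -> m.-integrable setT (F \o f).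
Proof.
move=> pf /integrableP[mF iF]; apply/integrableP; split.
  exact: (measurableT_comp mF pf.1).
rewrite (preserves_ge0_integral (F := fun x => `|F x|%E) pf)//.
exact: measurableT_comp.
Qed.

Lemma preserves_integral f (F : T -> \bar R) : preserves m f ->
  m.-integrable setT F -> (\int[m]_x F (f x) = \int[m]_x F x)%E.
Proof.
move=> pf iF; have [mF _] := integrableP _ _ _ iF.
rewrite integralE [RHS]integralE; congr (_ - _)%E.
  under eq_integral do rewrite funepos_comp/=.
  by apply: preserves_ge0_integral => //; exact: measurable_funepos.
under eq_integral do rewrite funeneg_comp/=.
by apply: preserves_ge0_integral => //; exact: measurable_funeneg.
Qed.

Lemma preserves_ae f (P : T -> Prop) : preserves m f ->
  {ae m, forall x, P x} -> {ae m, forall x, P (f x)}.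
Proof.
move=> [mf pf] [A [mA A0 PA]]; exists (f @^-1` A); split.
- exact: measurable_preimageT.
- by rewrite pf.
- by move=> x /= nP; exact: PA.
Qed.

End preserving.

Section preserving_product.
Context {R : realType} d (T : measurableType d).
Variable m : {sigma_finite_measure set T -> \bar R}.

Lemma preserves_prod f g : preserves m f -> preserves m g ->
  preserves (m \x m)%E (fun p => (f p.1, g p.2)).
Proof.
move=> [mf pf] [mg pg].
have mh : measurable_fun setT (fun p : T * T => (f p.1, g p.2)).
  apply: measurable_fun_pair.
    exact: (measurableT_comp mf measurable_fst).
  exact: (measurableT_comp mg measurable_snd).
split=> // A mA.
pose h := measure_function_pushforward__canonical__measure_function_Measure
  (m \x m)%E mh.
apply/esym; apply: (product_measure_unique (m' := h)) => //= B C mB mC.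
rewrite /pushforward (_ : _ @^-1` _ = (f @^-1` B) `*` (g @^-1` C))//.
have mfB : measurable (f @^-1` B) by exact: measurable_preimageT.
have mgC : measurable (g @^-1` C) by exact: measurable_preimageT.
rewrite product_measure1E//.
by congr (_ * _)%E; [exact: pf|exact: pg].
Qed.

Lemma preserves_swap : preserves (m \x m)%E (fun p : T * T => (p.2, p.1)).
Proof.
have mh : measurable_fun setT (fun p : T * T => (p.2, p.1)).
  exact: measurable_fun_pair.
split=> // A mA.
pose h := measure_function_pushforward__canonical__measure_function_Measure
  (m \x m)%E mh.
apply/esym; apply: (product_measure_unique (m' := h)) => //= B C mB mC.
rewrite /pushforward (_ : _ @^-1` _ = C `*` B)//.
  by rewrite product_measure1E// muleC.
by apply/seteqP; split => -[x y] [].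
Qed.

End preserving_product.

(** * Shears, translations and reflections preserve Lebesgue measure *)

Section lebesgue1.
Context {R : realType}.
Notation leb := (@lebesgue_measure R).

Lemma lebesgue_measure_translate (a : R) (A : set R) : measurable A ->
  leb ((fun t => t + a) @^-1` A) = leb A.
Proof.
move=> mA.
have ma : measurable_fun setT
    ((fun t => t + a) : measurableTypeR R -> measurableTypeR R).
  exact: measurable_funD.
pose h :=
  measure_function_pushforward__canonical__measure_function_Measure leb ma.
apply/esym; apply: (lebesgue_measure_unique (mu := h)) => // X [[x y] /= xy <-].
rewrite /= /pushforward (_ : _ @^-1` _ = `]x - a, y - a]%classic).
  rewrite !lebesgue_measure_itv/= !lte_fin ltrD2r.
  by case: ifP => // _; rewrite -!EFinB; congr EFin; ring.
by apply/seteqP; split => t /=; rewrite !in_itv/= ltrBlDr lerBrDr.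
Qed.

Lemma lebesgue_measure_affine (s a : R) (A : set R) :
  s = 1 \/ s = -1 -> measurable A ->
  leb ((fun t => s * t + a) @^-1` A) = leb A.
Proof.
move=> [->|->] mA.
  by under eq_fun do rewrite mul1r; exact: lebesgue_measure_translate.
rewrite (_ : _ @^-1` _ = -%R @^-1` ((fun t => t + a) @^-1` A)); last first.
  by apply/seteqP; split => t /=; rewrite mulN1r.
have mB : measurable ((fun t : R => t + a) @^-1` A).
  rewrite -[X in measurable X]setTI.
  by apply: (_ : measurable_fun setT _) => //; exact: measurable_funD.
by have := lebesgue_measureN mB; rewrite /= lebesgue_measure_translate.
Qed.

End lebesgue1.

Section shear.
Context {R : realType}.
Notation leb := (@lebesgue_measure R).

(** For [sg = 1], and [f] depending only on the coordinates outside [s], this is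
    a shear; [sg = -1] adds the point reflection in the coordinates in [s]. *)
Definition shear n (s : pred 'I_n) (sg : R) (f : 'I_n -> 'rV[R]_n -> R)
    (x : 'rV[R]_n) : 'rV[R]_n :=
  \row_i (if s i then sg * x ord0 i + f i x else x ord0 i).

Lemma measurable_shear n (s : pred 'I_n) (sg : R)
    (f : 'I_n -> 'rV[R]_n -> R) :
  (forall i, measurable_fun setT (f i)) -> measurable_fun setT (shear s sg f).
Proof.
move=> mf; apply/measurable_fun_rVP => i; under eq_fun do rewrite mxE.
case: (s i); last exact: measurable_coord.
apply: measurable_funD => //; apply: measurable_funM => //.
exact: measurable_coord.
Qed.

Lemma product_measure12 d1 d2 (T1 : measurableType d1) (T2 : measurableType d2)
    (m1 : {sigma_finite_measure set T1 -> \bar R})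
    (m2 : {sigma_finite_measure set T2 -> \bar R}) (A : set (T1 * T2)) :
  measurable A -> (m1 \x m2)%E A = (m1 \x^ m2)%E A.
Proof.
move=> mA; apply: product_measure_unique => // B C mB mC /=.
exact: product_measure2E.
Qed.

(** If the displacement depends only on the coordinates that are kept, then by
    Fubini the map acts on each line in a moving direction as t |-> +-t + a.
    The induction splits off the first coordinate: when it moves, its
    displacement depends only on the remaining ones, and the product measure is
    computed by sections over these; when it is kept, each section over it is
    again transformed by a shear.  Translations, point reflections and the
    factors of a hyperplane reflection are all of this form. *)
Lemma lebesgue_rV_shear n (s : pred 'I_n) (sg : R)
    (f : 'I_n -> 'rV[R]_n -> R) :
  sg = 1 \/ sg = -1 -> (forall i, measurable_fun setT (f i)) ->
  (forall i (x y : 'rV[R]_n),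
    (forall j, ~~ s j -> x ord0 j = y ord0 j) -> f i x = f i y) ->
  preserves (lebesgue_rV n) (shear s sg f).
Proof.
move=> sg1; elim: n s f => [|n IH] s f mf fs.
  split; first exact: measurable_shear.
  move=> A mA; congr (lebesgue_rV 0 _); rewrite (_ : shear s sg f = id)//.
  by apply/funext => x; apply/rowP => -[].
split; first exact: measurable_shear.
move=> A mA.
have mcons := @measurable_cons_rV R n.
pose B : set (R * 'rV[R]_n) := @cons_rV R n @^-1` A.
have mB : measurable B by exact: measurable_preimageT.
pose C : set (R * 'rV[R]_n) := @cons_rV R n @^-1` (shear s sg f @^-1` A).
have mC : measurable C.
  by apply: measurable_preimageT => //; apply: measurable_preimageT => //;
    exact: measurable_shear.
change ((leb \x lebesgue_rV n)%E C = (leb \x lebesgue_rV n)%E B).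
pose s' : pred 'I_n := fun j => s (lift ord0 j).
have cons_fst (t u : R) (x : 'rV[R]_n) (i : 'I_n.+1) : s ord0 ->
    f i (cons_rV (t, x)) = f i (cons_rV (u, x)).
  move=> s0; apply: fs => j sj; rewrite !mxE; case: unliftP => //= j0.
  by move: sj; rewrite j0 s0.
have mcons_t (t : R) : measurable_fun setT (fun x : 'rV[R]_n => cons_rV (t, x)).
  by apply: (measurableT_comp mcons); exact: measurable_fun_pair.
pose f' t j x := f (lift ord0 j) (cons_rV (t, x)).
have IH' t : preserves (lebesgue_rV n) (shear s' sg (f' t)).
  apply: IH => [i|i x y xy]; first exact: (measurableT_comp (mf _) (mcons_t t)).
  apply: fs => j sj; rewrite !mxE; case: unliftP => //= k jk.
  by apply: xy; rewrite /s' -jk.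
have shearE t x : shear s sg f (cons_rV (t, x)) =
    cons_rV (if s ord0 then sg * t + f ord0 (cons_rV (0, x)) else t,
             shear s' sg (f' t) x).
  apply/rowP => i; rewrite !mxE; case: unliftP => [j ->|->] /=.
    by rewrite mxE.
  by case: ifPn => // s0; rewrite (cons_fst t 0).
case s0 : (s ord0).
  rewrite !product_measure12// /product_measure2.
  rewrite -[RHS](preserves_ge0_integral (IH' 0)); last 2 first.
  - exact: measurable_fun_ysection.
  - by move=> x.
  apply: eq_integral => x _ /=.
  rewrite -[RHS](@lebesgue_measure_affine _ sg
    (f ord0 (cons_rV (0, x))))//; last first.
    exact: measurable_ysection.
  congr (leb _); apply/seteqP; split => t /=;
    rewrite !ysectionE /C /B /= shearE s0;
    by rewrite (_ : f' t = f' 0)//; apply/funext => j; apply/funext => y;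
      exact: cons_fst.
apply: eq_integral => t _ /=.
rewrite -[RHS](IH' t).2; last exact: measurable_xsection.
congr (lebesgue_rV n _); apply/seteqP; split => x /=;
  by rewrite !xsectionE /C /B /= shearE s0.
Qed.

End shear.

Section isometries.
Context {R : realType} {n : nat}.
Notation mu := (@lebesgue_rV R n).
Implicit Types (a e x y : 'rV[R]_n) (b : R).

Lemma preserves_addr a : preserves mu (fun x => x + a).
Proof.
rewrite (_ : (fun x => x + a) = shear predT 1 (fun i _ => a ord0 i)).
  by apply: lebesgue_rV_shear => //; left.
by apply/funext => x; apply/rowP => i; rewrite !mxE mul1r.
Qed.

Lemma preserves_subl a : preserves mu (fun x => a - x).
Proof.
rewrite (_ : (fun x => a - x) = shear predT (-1) (fun i _ => a ord0 i)).
  by apply: lebesgue_rV_shear => //; right.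
by apply/funext => x; apply/rowP => i; rewrite !mxE mulN1r addrC.
Qed.

Lemma dotrV_ge0 e : 0 <= dotrV e e.
Proof. by apply: sumr_ge0 => i _; rewrite -expr2 sqr_ge0. Qed.

Lemma dotrV_gt0 e : e != 0 -> 0 < dotrV e e.
Proof.
move=> e0; rewrite lt_def dotrV_ge0 andbT; apply: contra e0 => /eqP ee0.
apply/eqP/rowP => i; rewrite mxE; apply/eqP.
have /psumr_eq0P/(_ ee0)/(_ i erefl)/eqP :
    forall j : 'I_n, true -> 0 <= e ord0 j * e ord0 j.
  by move=> j _; rewrite -expr2 sqr_ge0.
by rewrite mulf_eq0 orbb.
Qed.

Lemma dotrVB e x y : dotrV e (x - y) = dotrV e x - dotrV e y.
Proof.
rewrite /dotrV -sumrB; apply: eq_bigr => i _.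
by rewrite !mxE mulrBr.
Qed.

Lemma dotrVZ e (t : R) x : dotrV e (t *: x) = t * dotrV e x.
Proof.
by rewrite /dotrV mulr_sumr; apply: eq_bigr => i _; rewrite !mxE mulrCA.
Qed.

Lemma dotrV_reflection e b x : e != 0 ->
  dotrV e (reflection e b x) = 2 * b - dotrV e x.
Proof.
move=> /dotrV_gt0 ee; rewrite /reflection dotrVB dotrVZ.
field; exact: lt0r_neq0.
Qed.

Lemma reflectionK e b : e != 0 -> involutive (reflection e b).
Proof.
move=> e0 x; rewrite {1}/reflection dotrV_reflection//.
apply/rowP => i; rewrite !mxE; field.
by apply: lt0r_neq0; exact: dotrV_gt0.
Qed.

Lemma measurable_dotrV e : measurable_fun setT (dotrV e).
Proof.
apply: measurable_sum => i; apply: measurable_funM => //.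
exact: measurable_coord.
Qed.

(** Choose k with e_k <> 0.  The shear [P 1] sends the k-th basis vector to
    e / e_k, a multiple of the reflected direction, and fixes the other basis
    vectors; its inverse is [P (-1)].  Conjugated by [P 1] the reflection
    therefore changes only the k-th coordinate, with coefficient -1 on that
    coordinate: it is the shear [K]. *)
Lemma preserves_reflection e b : e != 0 -> preserves mu (reflection e b).
Proof.
move=> e0.
have [k ek0] : exists k, e ord0 k != 0.
  apply/existsP; apply: contra e0 => /pred0P ek; apply/eqP/rowP => i.
  by have := ek i; rewrite mxE /= => /negbFE/eqP.
pose P c :=
  shear (predC1 k) 1 (fun i x => c * (e ord0 i / e ord0 k) * x ord0 k).
pose K := shear (pred1 k) (- 1) (fun _ x => - (2 * e ord0 k / dotrV e e) *
  (\sum_(j < n | j != k) e ord0 j * x ord0 j - b)).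
have PP c : preserves mu (P c).
  apply: lebesgue_rV_shear; first by left.
    by move=> i; apply: measurable_funM => //; exact: measurable_coord.
  by move=> i x y xy; rewrite xy//= negbK.
have PK : preserves mu K.
  apply: lebesgue_rV_shear; first by right.
    move=> _; apply: measurable_funM => //; apply: measurable_funB => //.
    under eq_fun do rewrite big_mkcond/=.
    apply: measurable_sum => j; case: (j != k) => //.
    by apply: measurable_funM => //; exact: measurable_coord.
  by move=> _ x y xy; congr (_ * (_ - _)); apply: eq_bigr => j /xy ->.
rewrite (_ : reflection e b = P 1 \o K \o P (-1)).
  exact/preserves_comp/PP/preserves_comp/PK/PP.
have ee := lt0r_neq0 (dotrV_gt0 e0).
have dotk x : dotrV e x =
    e ord0 k * x ord0 k + \sum_(j < n | j != k) e ord0 j * x ord0 j.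
  by rewrite /dotrV (bigD1 k).
have KP x : K (P (-1) x) ord0 k =
    x ord0 k - (2 * (dotrV e x - b) / dotrV e e) * e ord0 k.
  rewrite mxE /= eqxx [P _ _ _ k]mxE /= eqxx /=.
  rewrite (eq_bigr (fun j => e ord0 j * x ord0 j -
    (x ord0 k / e ord0 k) * (e ord0 j * e ord0 j))).
    rewrite sumrB -mulr_sumr.
    have -> : \sum_(j < n | j != k) e ord0 j * e ord0 j =
        dotrV e e - e ord0 k * e ord0 k.
      by apply/eqP; rewrite eq_sym subr_eq dotk addrC.
    have -> : \sum_(j < n | j != k) e ord0 j * x ord0 j =
        dotrV e x - e ord0 k * x ord0 k.
      by apply/eqP; rewrite eq_sym subr_eq dotk addrC.
    by field; rewrite ee ek0.
  move=> j jk; rewrite mxE /= jk; field; exact: ek0.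
apply/funext => x; apply/rowP => i /=; rewrite [P 1 _ _ _]mxE /=.
case: eqP => [->|/eqP ik] /=; first by rewrite KP !mxE.
rewrite KP !mxE /= (negbTE ik) ?mxE /= ?ik.
by field; rewrite ee ek0.
Qed.

End isometries.

(** * Integrals of almost everywhere equal functions *)

Section ae_integral.
Local Open Scope ereal_scope.
Context {R : realType} d (T : measurableType d).
Variable m : {measure set T -> \bar R}.
Import HBNNSimple.

Let ge0_integral_ae_le (f g : T -> \bar R) :
  (forall x, 0 <= f x) -> (forall x, 0 <= g x) ->
  {ae m, forall x, f x = g x} -> \int[m]_x f x <= \int[m]_x g x.
Proof.
move=> f0 g0 [N [mN N0 fgN]].
rewrite ge0_integralTE// ge0_integralTE//.
apply: ge_ereal_sup => _ [h /= hf <-].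
pose h' := mul_nnsfun h (indic_nnsfun R (measurableC mN)).
rewrite -integralT_nnsfun.
have hh' : \int[m]_x (h x)%:E = \int[m]_x (h' x)%:E.
  apply: ge0_ae_eq_integral => //.
  - by apply/measurable_EFinP.
  - by apply/measurable_EFinP.
  - by move=> x _; rewrite lee_fin.
  - by move=> x _; rewrite lee_fin.
  exists N; split => // x /= => /not_implyP[_] hx.
  apply: contrapT => Nx; apply: hx.
  by rewrite /= mindicE mem_set//= mulr1.
rewrite hh' integralT_nnsfun; apply: ereal_sup_ubound; exists h' => //= x.
rewrite /= mindicE; have [Nx|Nx] := boolP (x \in ~` N); last by rewrite mulr0.
rewrite mulr1 (_ : g x = f x)//; apply/esym; apply: contrapT => fg.
by have /= := set_mem Nx; apply; exact: fgN.
Qed.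

(** Lower sums do not see null sets: multiplying a simple function below [f] by
    the indicator of the complement of a Borel null set containing the points
    where [f] and [g] differ puts it below [g] and keeps its integral.  The
    argument covers arbitrary integrands, in particular iterated integrals of
    functions that are only Lebesgue measurable. *)
Lemma ae_integral_congr (D : set T) (f g : T -> \bar R) :
  {ae m, forall x, D x -> f x = g x} ->
  \int[m]_(x in D) f x = \int[m]_(x in D) g x.
Proof.
move=> fg; rewrite integral_mkcond [RHS]integral_mkcond.
have fgD : {ae m, forall x, (f \_ D) x = (g \_ D) x}.
  by apply: filterS fg => x fgx; rewrite !patchE; case: ifPn => // /set_mem/fgx.
rewrite integralE [RHS]integralE; congr (_ - _).
- by apply/eqP; rewrite eq_le !ge0_integral_ae_le//;
    apply: filterS fgD => x fgx; rewrite !funeposE fgx.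
- by apply/eqP; rewrite eq_le !ge0_integral_ae_le//;
    apply: filterS fgD => x fgx; rewrite !funenegE fgx.
Qed.

End ae_integral.

Lemma integral_indicl {R : realType} d (T : measurableType d)
    (m : {measure set T -> \bar R}) (A : set T) (f : T -> R) :
  (\int[m]_(x in A) (f x)%:E = \int[m]_x (\1_A x * f x)%:E)%E.
Proof.
rewrite integral_mkcond; apply: eq_integral => x _.
by rewrite patchE indicE; case: (x \in A); rewrite ?mul1r ?mul0r.
Qed.

(** * Borel sets and Euclidean distance in R^n *)

Section rV_topology.
Context {R : realType} {n : nat}.
Notation mu := (@lebesgue_rV R n).
Implicit Types (x y a : 'rV[R]_n).

Definition box_rV a (r : R) : set 'rV[R]_n :=
  [set x | forall i, `|x ord0 i - a ord0 i| < r].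

Lemma measurable_box_rV a r : measurable (box_rV a r).
Proof.
rewrite (_ : box_rV a r = \bigcap_(i in [set: 'I_n])
    [set x | `|x ord0 i - a ord0 i| < r]); last first.
  by apply/seteqP; split => x h; [move=> i _|move=> i]; exact: h.
apply: fin_bigcap_measurable => // i _.
have mf : measurable_fun setT (fun x => `|x ord0 i - a ord0 i|).
  apply: measurableT_comp => //; apply: measurable_funB => //.
  exact: measurable_coord.
rewrite [X in measurable X](_ : _ = setT `&`
    (fun x => `|x ord0 i - a ord0 i|) @^-1` `]-oo, r[%classic).
  exact: mf.
by rewrite setTI; apply/seteqP; split => x /=; rewrite in_itv.
Qed.

Lemma ball_rVP x (r : R) y :
  0 < r -> ball x r y <-> forall i, `|x ord0 i - y ord0 i| < r.
Proof.
move=> r0; split => [[_ h] i|h]; first exact: h.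
by split => // i j; rewrite ord1; exact: h.
Qed.

(** The open cubes with rational centre and radius 1/(k+1) form a countable
    base, so the sigma-algebra generated by the coordinates contains the open
    sets. *)
Lemma measurable_open_rV (U : set 'rV[R]_n) : open U -> measurable U.
Proof.
move=> oU.
pose ratV (q : 'rV[rat]_n) : 'rV[R]_n := \row_i ratr (q ord0 i).
pose F (p : 'rV[rat]_n * nat) :=
  if `[< box_rV (ratV p.1) p.2.+1%:R^-1 `<=` U >]
  then box_rV (ratV p.1) p.2.+1%:R^-1 else set0.
rewrite (_ : U = \bigcup_p F p).
  apply: countable_bigcupT_measurable => [|p].
    exact: countableP.
  by rewrite /F; case: ifP => // _; exact: measurable_box_rV.
apply/seteqP; split => x; last first.
  by move=> [p _]; rewrite /F; case: asboolP => // + xb; exact.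
move=> Ux; have /nbhs_ballP[r /= r0 xrU] : nbhs x U by exact: open_nbhs_nbhs.
have [k kr] : exists k : nat, k.+1%:R^-1 < r / 2.
  have [k _ /(_ k (leqnn k)) hk] :=
    near_infty_natSinv_lt (PosNum (divr_gt0 r0 (ltr0n R 2))).
  by exists k.
have k0 : 0 < k.+1%:R^-1 :> R by rewrite invr_gt0 ltr0n.
have /choice[q hq] :
    forall i, exists q : rat, `|x ord0 i - ratr q| < k.+1%:R^-1.
  move=> i.
  have [|q] := @rat_in_itvoo R (x ord0 i - k.+1%:R^-1) (x ord0 i + k.+1%:R^-1).
    by rewrite ltrD2l (lt_trans _ k0)// oppr_lt0.
  rewrite in_itv/= => /andP[q1 q2]; exists q.
  by rewrite distrC ltr_distl q1 q2.
exists (\row_i q i, k) => //; rewrite /F asboolT/=.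
  by move=> i; rewrite !mxE; exact: hq.
move=> y hy; apply: xrU; apply/ball_rVP => // i.
have := hy i; rewrite !mxE => hyi.
have -> : x ord0 i - y ord0 i =
    (x ord0 i - ratr (q i)) - (y ord0 i - ratr (q i)) by ring.
rewrite (le_lt_trans (ler_normB _ _))//.
by rewrite [ltRHS](splitr r) ltrD// (lt_trans _ kr).
Qed.

Lemma coord_le_enorm x i : `|x ord0 i| <= enorm x.
Proof.
rewrite -sqrtr_sqr ler_wsqrtr// expr2 /dotrV (bigD1 i)//= lerDl.
by apply: sumr_ge0 => j _; rewrite -expr2 sqr_ge0.
Qed.

(** By compactness one radius of a sup norm ball inside [U] works for all of
    [K], and the sup norm is at most the Euclidean one. *)
Lemma compact_open_margin (K U : set 'rV[R]_n) : compact K -> open U ->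
  K `<=` U -> exists2 r, 0 < r &
    forall x y, K x -> ~ U y -> r <= enorm (x - y).
Proof.
move=> /compact_near_coveringP cK oU KU.
have := cK _ (0^'+) (fun (r : R) x => ball x r `<=` U) _ _.
case.
  move=> x Kx; have /nbhs_ballP[r /= r0 xrU] : nbhs x U.
    by apply: open_nbhs_nbhs; split => //; exact: KU.
  exists (ball x (r / 2), [set t | t < r / 2]).
    split => /=; first by apply: nbhsx_ballx; rewrite divr_gt0.
    by apply: nbhs_right_lt; rewrite divr_gt0.
  move=> [y t] /= [xy tr] z yz; apply: xrU.
  apply: (@le_ball _ _ _ (r / 2 + t)).
    by rewrite [leRHS](splitr r) lerD2l ltW.
  exact: ball_triangle xy yz.
move=> r /= r0 hr; exists (r / 2) => [|x y Kx Uy]; first by rewrite divr_gt0.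
have r2 : 0 < r / 2 by rewrite divr_gt0.
rewrite leNgt; apply/negP => xy; apply: Uy; apply: (hr (r / 2) _ r2 x Kx).
  by rewrite /= sub0r normrN gtr0_norm// ltr_pdivrMr// ltr_pMr// ltr1n.
apply/ball_rVP => // i; rewrite (le_lt_trans _ xy)//.
by have := coord_le_enorm (x - y) i; rewrite !mxE.
Qed.

Lemma lebesgue_rV_set1 a : (0 < n)%N -> mu [set a] = 0%E.
Proof.
move: a; case: n => // k a _.
rewrite (_ : [set a] = [set v | forall i, [set a ord0 i] (v ord0 i)]).
  rewrite (lebesgue_rV_box (A := fun i => [set a ord0 i]))//.
  by rewrite big_ord_recl lebesgue_measure_set1 mul0e.
by apply/seteqP; split => x /= => [->//|h]; apply/rowP => i; exact: h.
Qed.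

Lemma measurable_set1_rV a : measurable [set a : 'rV[R]_n].
Proof.
rewrite (_ : [set a] = \bigcap_(i in [set: 'I_n])
    (setT `&` (fun x : 'rV[R]_n => x ord0 i) @^-1` [set a ord0 i])).
  by apply: fin_bigcap_measurable => // i _; exact: measurable_coord.
apply/seteqP; split => x /= => [-> i _|h]; first by split.
by apply/rowP => i; have [] := h i I.
Qed.

Lemma dim_gt0 x : x != 0 -> (0 < n)%N.
Proof. by case: n x => // x; rewrite [x]thinmx0 eqxx. Qed.

Lemma ae_neq0 : (0 < n)%N -> {ae mu, forall z, z != 0}.
Proof.
move=> n0; exists [set 0]; split; [exact: measurable_set1_rV| |].
  exact: lebesgue_rV_set1.
by move=> z /= /negP/negPn/eqP.
Qed.

Lemma measurable_enorm : measurable_fun setT (@enorm R n).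
Proof.
apply: (measurableT_comp (f := @Num.sqrt R)).
  by apply: continuous_measurable_fun; exact: sqrt_continuous.
apply: measurable_sum => i.
by apply: measurable_funM; exact: measurable_coord.
Qed.

Lemma measurable_enorm_ge (r : R) :
  measurable [set x : 'rV[R]_n | r <= enorm x].
Proof.
rewrite (_ : [set _ | _] = @enorm R n @^-1` `[r, +oo[).
  by apply: measurable_preimageT => //; exact: measurable_enorm.
by apply/seteqP; split => x /=; rewrite in_itv/= andbT.
Qed.

Lemma enorm_subC x y : enorm (x - y) = enorm (y - x).
Proof.
rewrite /enorm; congr Num.sqrt; apply: eq_bigr => i _.
by rewrite !mxE -mulrNN !opprB.
Qed.

End rV_topology.

(** * Testing an antisymmetric function with its negative part *)

Section negative_part.
Context {R : realType} d (T : measurableType d).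
Variable m : {sigma_finite_measure set T -> \bar R}.
Notation mm := (m \x m)%E.

Definition negpart_on (U : set T) (v : T -> R) (x : T) : R :=
  if x \in U then Num.max (- v x) 0 else 0.

(** [Q] is the reflection, [H] the half space, [K] the kernel J(x - y).  The
    integrable functions [E] and [D] dominate the energy density of [v] on
    [U' x U'], and v(x)^2 K(x,y) when one of x, y lies in [U] and the other
    outside [U'], respectively. *)
Variables (Q : T -> T) (H U U' : set T) (v : T -> R) (K E D : T * T -> R).
Hypotheses (Qm : preserves m Q) (QQ : involutive Q).
Hypothesis HQ : forall x, H x -> ~ H (Q x).
Hypothesis HQT : forall x, [\/ H x, H (Q x) | Q x = x].
Hypotheses (mU : measurable U) (UH : U `<=` H) (UU' : U `<=` U').
Hypothesis QU' : forall x, U' x -> U' (Q x).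
Hypotheses (mK : measurable_fun setT K) (K0 : forall p, 0 <= K p).
Hypothesis Ksym : forall x y, K (x, y) = K (y, x).
Hypothesis Khalf : forall x y, H x -> H y -> K (x, Q y) <= K (x, y).
Hypotheses (mv : measurable_fun setT v) (vQ : forall x, v (Q x) = - v x).
Hypothesis v_ge0 : forall x, H x -> ~ U x -> 0 <= v x.
Hypotheses (E0 : forall p, 0 <= E p) (D0 : forall p, 0 <= D p).
Hypotheses (iE : mm.-integrable setT (EFin \o E))
  (iD : mm.-integrable setT (EFin \o D)).
Hypothesis vE : forall x y, U' x -> U' y ->
  (v x - v y) ^+ 2 * K (x, y) <= E (x, y).
Hypothesis vD : forall x y, U x /\ ~ U' y \/ ~ U' x /\ U y ->
  v x ^+ 2 * K (x, y) <= D (x, y).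

Let phi := negpart_on U v.
Let w x := v x + phi x.

Lemma measurable_negpart_on : measurable_fun setT (negpart_on U v).
Proof.
rewrite (_ : negpart_on U v = fun x => \1_U x * Num.max (- v x) 0).
  apply: measurable_funM => //; apply: measurable_maxr => //.
  exact: measurable_funN.
apply/funext => x; rewrite /negpart_on indicE.
by case: (x \in U); rewrite ?mul1r ?mul0r.
Qed.

Lemma negpart_on_ge0 x : 0 <= negpart_on U v x.
Proof. by rewrite /negpart_on; case: ifP => // _; rewrite le_max lexx orbT. Qed.

Lemma negpart_on_out x : ~ U x -> negpart_on U v x = 0.
Proof. by move=> Ux; rewrite /negpart_on memNset. Qed.

Lemma negpart_on_in x : U x -> negpart_on U v x = Num.max (- v x) 0.
Proof. by move=> Ux; rewrite /negpart_on mem_set. Qed.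

Let phi_gt0 x : 0 < phi x -> U x /\ v x = - phi x.
Proof.
rewrite /phi /negpart_on; case: ifPn => [/set_mem Ux|_]; last by rewrite ltxx.
by case: (ltP (- v x) 0) => _; rewrite ?ltxx// opprK.
Qed.

Let phi_eq0 x : phi x = 0 -> v x < 0 -> ~ U x.
Proof.
move=> + vx Ux; rewrite /phi negpart_on_in//.
by case: (ltP (- v x) 0); lra.
Qed.

Let phi_w x : phi x * w x = 0.
Proof.
rewrite /w /phi /negpart_on; case: ifP => _; last by rewrite mul0r.
by case: (ltP (- v x) 0) => _; rewrite ?mul0r// addrN mulr0.
Qed.

Let v_lt0_out y : ~ U y -> v y < 0 -> H (Q y).
Proof.
move=> Uy vy; case: (HQT y) => // [Hy|Qy].
  by have := v_ge0 Hy Uy; rewrite leNgt vy.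
by have := vQ y; rewrite Qy; lra.
Qed.

(* In the notation of the introduction: [P] is the energy density of [phi], and
   [B0 (x, y) + B0 (y, x)] is the common majorant. *)
Let P (p : T * T) := (phi p.1 - phi p.2) ^+ 2 * K p.
Let S (p : T * T) := phi p.1 * w p.2 * K p.
Let B0 (p : T * T) := E p + E (p.1, Q p.2) + (D p + D (p.2, p.1)).

Let B0_ge0 p : 0 <= B0 p.
Proof. by rewrite /B0 !addr_ge0. Qed.

Let K_refl x y : H x -> H (Q y) -> K (x, y) <= K (x, Q y).
Proof. by move=> Hx Hy; rewrite -{1}(QQ y); exact: Khalf. Qed.

(* Let phi(x) > 0, so v(x) = - phi(x) < 0.  For y in U' with v(y) >= 0, the
   product phi(x) v(y) is at most (v(x) - v(y))^2.  If v(y) < 0 and phi(y) = 0,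
   then Qy is in H and v(Qy) > 0, and K(x,y) <= K(x,Qy) moves the estimate to
   the point Qy.  For y outside U', use 2ab <= a^2 + b^2. *)
Let S_le x y : `|S (x, y)| <= B0 (x, y).
Proof.
rewrite /S /=; have := negpart_on_ge0 x.
rewrite -/(phi x) le_eqVlt => /predU1P[<-|].
  by rewrite !mul0r normr0.
move=> /[dup] phix /phi_gt0[Ux vx]; have Hx := UH Ux.
rewrite !normrM (ger0_norm (K0 _)) gtr0_norm//.
have [U'y|U'y] := pselect (U' y).
  have D00 : 0 <= D (x, y) + D (y, x) by rewrite addr_ge0.
  have [vy|vy] := leP 0 (v y).
    have -> : w y = v y.
      rewrite /w /phi /negpart_on; case: ifP => _; last by rewrite addr0.
      by case: (ltP (- v y) 0); lra.
    rewrite (ger0_norm vy) /B0 /= -addrA ler_wpDr//; first by rewrite addr_ge0.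
    apply: le_trans (vE (UU' Ux) U'y); rewrite ler_wpM2r// vx; nra.
  have [phiy|phiy] := eqVneq (phi y) 0; last first.
    have := phi_w y => /eqP; rewrite mulf_eq0 (negbTE phiy)/= => /eqP ->.
    by rewrite normr0 mulr0 mul0r.
  have HQy := v_lt0_out (phi_eq0 phiy vy) vy.
  rewrite /w phiy addr0 ltr0_norm//.
  rewrite /B0 /= -addrA addrCA ler_wpDr//; first by rewrite addr_ge0.
  apply: le_trans (vE (UU' Ux) (QU' U'y)).
  apply: (@le_trans _ _ (phi x * - v y * K (x, Q y))).
    by rewrite ler_wpM2l// ?K_refl// mulr_ge0 ?ltW// oppr_gt0.
  by rewrite ler_wpM2r// vx vQ; nra.
have Uy : ~ U y by move=> /UU'.
rewrite /w /phi (negpart_on_out Uy) addr0 -/(phi x).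
rewrite /B0 /= ler_wpDl//; first by rewrite addr_ge0.
apply: le_trans (lerD (vD (or_introl (conj Ux U'y)))
  (vD (or_intror (conj U'y Ux)))).
rewrite (Ksym y x) -mulrDl ler_wpM2r// vx -(real_normK (num_real (v y))).
have := normr_ge0 (v y); nra.
Qed.

(* The density is symmetric, so it suffices to treat phi(y) <= phi(x); then the
   cases are those of [S_le], as (phi(x) - phi(y))^2 <= phi(x)^2. *)
Let P_le_half x y : phi y <= phi x -> P (x, y) <= B0 (x, y).
Proof.
move=> yx; rewrite /P /=.
have phiy0 : 0 <= phi y by exact: negpart_on_ge0.
have := negpart_on_ge0 x; rewrite -/(phi x) le_eqVlt => /predU1P[x0|].
  have -> : phi y = 0 by apply/eqP; rewrite eq_le phiy0 x0 yx.
  by rewrite -x0 subrr expr0n mul0r.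
move=> /[dup] phix /phi_gt0[Ux vx]; have Hx := UH Ux.
have [U'y|U'y] := pselect (U' y).
  have D00 : 0 <= D (x, y) + D (y, x) by rewrite addr_ge0.
  have [phiy|phiy] := eqVneq (phi y) 0; last first.
    have [|Uy vy] := @phi_gt0 y; first by rewrite lt_def phiy.
    rewrite /B0 /= -addrA ler_wpDr//; first by rewrite addr_ge0.
    apply: le_trans (vE (UU' Ux) U'y).
    by rewrite vx vy -opprD sqrrN.
  rewrite phiy subr0.
  have [vy|vy] := leP 0 (v y).
    rewrite /B0 /= -addrA ler_wpDr//; first by rewrite addr_ge0.
    apply: le_trans (vE (UU' Ux) U'y); rewrite ler_wpM2r// vx; nra.
  have HQy := v_lt0_out (phi_eq0 phiy vy) vy.
  rewrite /B0 /= -addrA addrCA ler_wpDr//; first by rewrite addr_ge0.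
  apply: le_trans (vE (UU' Ux) (QU' U'y)).
  apply: (@le_trans _ _ (phi x ^+ 2 * K (x, Q y))).
    by rewrite ler_wpM2l// ?K_refl// sqr_ge0.
  by rewrite ler_wpM2r// vx vQ; nra.
have Uy : ~ U y by move=> /UU'.
rewrite {2}/phi (negpart_on_out Uy) subr0.
rewrite /B0 /= ler_wpDl//; first by rewrite addr_ge0.
rewrite ler_wpDr//.
by apply: le_trans (vD (or_introl (conj Ux U'y))); rewrite vx sqrrN.
Qed.

Let P_le x y : P (x, y) <= B0 (x, y) + B0 (y, x).
Proof.
have [yx|/ltW xy] := leP (phi y) (phi x).
  by rewrite (le_trans (P_le_half yx))// lerDl.
rewrite (_ : P (x, y) = P (y, x)).
  by rewrite (le_trans (P_le_half xy))// lerDr.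
by rewrite /P /= Ksym -sqrrN opprB.
Qed.

Let S_sym_ge0 x y : 0 <= S (x, y) + S (x, Q y).
Proof.
have phix : 0 <= phi x by exact: negpart_on_ge0.
rewrite /S /= -!mulrA -mulrDr.
move: phix; rewrite le_eqVlt => /predU1P[<-|phix]; first by rewrite mul0r.
apply: mulr_ge0; first exact: ltW.
have [Ux _] := phi_gt0 phix; have Hx := UH Ux.
have wH z : H z -> 0 <= w z * K (x, z) + w (Q z) * K (x, Q z).
  move=> Hz; have UQz : ~ U (Q z) by move=> /UH; exact: HQ.
  have -> : w (Q z) = - v z by rewrite /w /phi negpart_on_out// addr0 vQ.
  have vw : v z <= w z by rewrite lerDl negpart_on_ge0.
  have w0 : 0 <= w z.
    rewrite /w /phi; have [Uz|Uz] := pselect (U z).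
      by rewrite negpart_on_in//; case: (ltP (- v z) 0); lra.
    by rewrite negpart_on_out// addr0 v_ge0.
  have [K1 K2] := (K0 (x, z), K0 (x, Q z)).
  have KK := Khalf Hx Hz; nra.
case: (HQT y) => [|HQy|Qy]; first exact: wH.
  by have := wH _ HQy; rewrite QQ addrC.
have vy : v y = 0 by have := vQ y; rewrite Qy; lra.
have Uy : ~ U y by move=> /UH Hy; have := HQ Hy; rewrite Qy.
by rewrite Qy /w vy /phi negpart_on_out// addr0 mul0r addr0.
Qed.

Let mphi : measurable_fun setT phi.
Proof. exact: measurable_negpart_on. Qed.

Let mw : measurable_fun setT w.
Proof. exact: measurable_funD. Qed.

Let preserves_idQ : preserves mm (fun p => (p.1, Q p.2)).
Proof. by apply: (preserves_prod (f := id)) => //; split. Qed.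

Let integrable_B0 : mm.-integrable setT (EFin \o B0).
Proof.
have -> : EFin \o B0 =
    ((EFin \o E) \+ ((EFin \o E) \o (fun p => (p.1, Q p.2)))) \+
    ((EFin \o D) \+ ((EFin \o D) \o (fun p => (p.2, p.1))))
    :> (T * T -> \bar R).
  by apply/funext => p.
apply: integrableD => //; apply: integrableD => //.
  exact: preserves_integrable.
apply: preserves_integrable => //; exact: preserves_swap.
Qed.

Let integrable_S : mm.-integrable setT (EFin \o S).
Proof.
apply: le_integrable integrable_B0 => //.
  apply/measurable_EFinP; apply: measurable_funM => //.
  apply: measurable_funM.
    exact: (measurableT_comp mphi measurable_fst).
  exact: (measurableT_comp mw measurable_snd).
by move=> [x y] _ /=; rewrite lee_fin [leRHS]ger0_norm.
Qed.

Lemma integrable_energy_negpart : mm.-integrable setT (EFin \o P).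
Proof.
have iB : mm.-integrable setT
    ((EFin \o B0) \+ ((EFin \o B0) \o (fun p => (p.2, p.1)))).
  apply: integrableD => //; apply: preserves_integrable => //.
  exact: preserves_swap.
apply: le_integrable iB => //.
  apply/measurable_EFinP; apply: measurable_funM => //.
  apply: measurable_funX; apply: measurable_funB.
    exact: (measurableT_comp mphi measurable_fst).
  exact: (measurableT_comp mphi measurable_snd).
move=> [x y] _ /=; rewrite lee_fin !ger0_norm ?addr_ge0//.
by rewrite mulr_ge0// sqr_ge0.
Qed.

Let A (p : T * T) := (v p.1 - v p.2) * (phi p.1 - phi p.2) * K p.

(* Here phi w = 0 enters. *)
Let AE : EFin \o A =
  (fun p => - ((EFin \o S) p + (EFin \o S) (p.2, p.1)) - (EFin \o P) p)%E.
Proof.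
apply/funext => -[x y].
change (EFin (A (x, y)) = EFin (- (S (x, y) + S (y, x)) - P (x, y))).
congr EFin; rewrite /A /S /P /= (Ksym y x).
have := phi_w x; have := phi_w y; rewrite /w => Hy Hx.
transitivity ((phi x * (v x + phi x) + phi y * (v y + phi y) -
  (phi x * (v y + phi y) + phi y * (v x + phi x)) -
  (phi x - phi y) ^+ 2) * K (x, y)).
  ring.
by rewrite Hx Hy; ring.
Qed.

Let integrable_SS :
  mm.-integrable setT (fun p => (EFin \o S) p + (EFin \o S) (p.2, p.1))%E.
Proof.
apply: integrableD => //.
by apply: (preserves_integrable (F := EFin \o S)) => //; exact: preserves_swap.
Qed.

Lemma integrable_energy_cross : mm.-integrable setT (EFin \o A).
Proof.
rewrite AE; apply: integrableB => //; last exact: integrable_energy_negpart.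
exact: (integrableN (f := fun p => (EFin \o S) p + (EFin \o S) (p.2, p.1))%E).
Qed.

(* Twice the integral of S is the integral of S(x,y) + S(x,Qy). *)
Let integral_S_ge0 : (0 <= \int[mm]_p (EFin \o S) p)%E.
Proof.
have iSQ := preserves_integrable preserves_idQ integrable_S.
have eS : (\int[mm]_p ((EFin \o S) p + (EFin \o S) (p.1, Q p.2)) =
    \int[mm]_p (EFin \o S) p + \int[mm]_p (EFin \o S) p)%E.
  rewrite (integralD measurableT integrable_S iSQ).
  by congr (_ + _)%E; exact: (preserves_integral preserves_idQ).
rewrite leNgt; apply/negP => S_lt0.
have : (0 <= \int[mm]_p ((EFin \o S) p + (EFin \o S) (p.1, Q p.2)))%E.
  apply: integral_ge0 => -[x y] _; rewrite /= -EFinD lee_fin.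
  exact: S_sym_ge0.
rewrite eS leNgt => /negP; apply.
by rewrite -[ltRHS]adde0 lteD.
Qed.

(** The density [A] of J(v,phi) is minus the sum of S, its transpose and [P], so
    its integrability is inherited from these, and the sign of the integral of
    S gives the inequality between the energies. *)
Theorem energy_cross_negpart :
  [/\ mm.-integrable setT (EFin \o P), mm.-integrable setT (EFin \o A) &
      (\int[mm]_p (A p)%:E <= - \int[mm]_p (P p)%:E)%E].
Proof.
have iP := integrable_energy_negpart.
split => //; first exact: integrable_energy_cross.
have -> : (\int[mm]_p (A p)%:E = \int[mm]_p
    (- ((EFin \o S) p + (EFin \o S) (p.2, p.1)) - (EFin \o P) p))%E.
  by congr (integral _ _ _); exact: AE.
rewrite (integralB measurableT (integrableN integrable_SS) iP).
rewrite -[leRHS]add0e leeB//.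
rewrite integralN; last exact: integrable_add_def.
rewrite oppe_le0.
have iST := preserves_integrable (preserves_swap m) integrable_S.
rewrite (integralD measurableT integrable_S iST).
apply: adde_ge0; first exact: integral_S_ge0.
rewrite (preserves_integral (preserves_swap m) integrable_S).
exact: integral_S_ge0.
Qed.

End negative_part.

(** * Borel representatives with exact symmetries *)

Section borel_representatives.
Context {R : realType} {n : nat}.
Notation mu := (@lebesgue_rV R n).
Implicit Types (e x y z : 'rV[R]_n) (b : R).

Lemma half_space_reflection e b x : e != 0 ->
  half_space e b (reflection e b x) <-> dotrV e x < b.
Proof. by move=> e0; rewrite /half_space /= dotrV_reflection//; split; lra. Qed.

Lemma half_space_reflectionN e b x : e != 0 ->
  half_space e b x -> ~ half_space e b (reflection e b x).
Proof.
move=> e0 Hx /(half_space_reflection _ _ e0).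
by move: Hx; rewrite /half_space /=; lra.
Qed.

Lemma half_space_cases e b x : e != 0 ->
  [\/ half_space e b x, half_space e b (reflection e b x) |
      reflection e b x = x].
Proof.
move=> e0; have [xb|bx|xb] := ltgtP (dotrV e x) b.
- by apply: Or32; exact/half_space_reflection.
- exact: Or31.
- by apply: Or33; rewrite /reflection xb subrr mulr0 mul0r scale0r subr0.
Qed.

Lemma measurable_half_space e b : measurable (half_space e b).
Proof.
rewrite (_ : half_space e b = setT `&` dotrV e @^-1` `]b, +oo[).
  exact: measurable_dotrV.
rewrite setTI; apply/seteqP; split => x;
  by rewrite /half_space /= in_itv/= andbT.
Qed.

Lemma measurable_rV_sub :
  measurable_fun setT (fun p : 'rV[R]_n * 'rV[R]_n => p.1 - p.2).
Proof.
apply/measurable_fun_rVP => i; under eq_fun do rewrite !mxE.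
apply: measurable_funB.
  exact: (measurableT_comp (measurable_coord i) measurable_fst).
exact: (measurableT_comp (measurable_coord i) measurable_snd).
Qed.

(** Let [Z] be a Borel null set containing 0 and all points where [J] differs
    from a Borel function.  Setting the kernel to 0 at every pair (x,y) for
    which one of the points x, Qx differs from one of y, Qy by an element of
    [Z], in either order, removes an invariant set of pairs.  So symmetry and
    monotonicity hold everywhere, whereas for each x only a null set of y is
    affected. *)
Lemma reflected_kernel e b (J : 'rV[R]_n -> R) : e != 0 ->
  (forall z, z != 0 -> 0 <= J z) -> lebesgue_measurable J ->
  (forall z, z != 0 -> J (- z) = J z) ->
  (forall x y, half_space e b x -> half_space e b y -> x != y ->
    J (x - reflection e b y) <= J (x - y)) ->
  exists K : 'rV[R]_n * 'rV[R]_n -> R,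
    [/\ measurable_fun setT K, forall p, 0 <= K p,
        forall x y, K (x, y) = K (y, x),
        forall x y, half_space e b x -> half_space e b y ->
          K (x, reflection e b y) <= K (x, y) &
        forall x, {ae mu, forall y, K (x, y) = J (x - y)}].
Proof.
move=> e0 J0 [g mg Jg] Jeven Jhalf.
set Q := reflection e b.
have QQ : involutive Q by exact: reflectionK.
have pQ : preserves mu Q by exact: preserves_reflection.
(* Including 0 in [Z] gives x <> y, and also x <> Qy, on the pairs kept. *)
have [Z [mZ Z0 hZ]] : {ae mu, forall z, J z = g z /\ z != 0}.
  by apply: filterS2 Jg (ae_neq0 (dim_gt0 e0)) => z.
have ZP z : ~ Z z -> J z = g z /\ z != 0.
  by move=> Zz; apply: contrapT => h; apply: Zz; exact: hZ.
have aeZ : {ae mu, forall z, ~ Z z}.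
  by exists Z; split => // z /= /contrapT.
pose G0 := [set p : 'rV[R]_n * 'rV[R]_n | ~ Z (p.1 - p.2) /\ ~ Z (p.2 - p.1)].
pose G := [set p |
  [/\ G0 p, G0 (p.1, Q p.2), G0 (Q p.1, p.2) & G0 (Q p.1, Q p.2)]].
have mG0 : measurable G0.
  apply: measurableI.
    exact: (measurable_preimageT measurable_rV_sub (measurableC mZ)).
  have mC : measurable_fun setT (fun p : 'rV[R]_n * 'rV[R]_n => p.2 - p.1).
    apply: (measurableT_comp measurable_rV_sub (g := fun p => (p.2, p.1))).
    exact: measurable_fun_pair.
  exact: (measurable_preimageT mC (measurableC mZ)).
have mQ1 : measurable_fun setT (fun p : 'rV[R]_n * 'rV[R]_n => Q p.1).
  exact: (measurableT_comp pQ.1 measurable_fst).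
have mQ2 : measurable_fun setT (fun p : 'rV[R]_n * 'rV[R]_n => Q p.2).
  exact: (measurableT_comp pQ.1 measurable_snd).
have mG : measurable G.
  rewrite (_ : G = (G0 `&` (fun p => (p.1, Q p.2)) @^-1` G0) `&`
    ((fun p => (Q p.1, p.2)) @^-1` G0 `&` (fun p => (Q p.1, Q p.2)) @^-1` G0)).
    by apply: measurableI; apply: measurableI => //;
      apply: measurable_preimageT => //; exact: measurable_fun_pair.
  by apply/seteqP; split => p /= => [[]|[[? ?] [? ?]]].
have G0C x y : G0 (x, y) -> G0 (y, x) by move=> [].
have GC x y : G (x, y) -> G (y, x) by move=> [/= ? ? ? ?]; split; exact: G0C.
have GQ x y : G (x, y) -> G (x, Q y).
  by move=> [/= h1 h2 h3 h4]; split => //=; rewrite QQ.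
have GQE x y : (x, Q y) \in G = ((x, y) \in G).
  apply/idP/idP; rewrite !inE => /GQ//; by rewrite QQ.
have GCE x y : (x, y) \in G = ((y, x) \in G).
  by apply/idP/idP; rewrite !inE => /GC.
have GJ x y : G (x, y) -> g (x - y) = J (x - y) /\ x - y != 0.
  by move=> [[/= /ZP[-> ?]]].
exists (fun p => \1_G p * g (p.1 - p.2)); split.
- apply: measurable_funM => //.
  exact: (measurableT_comp mg measurable_rV_sub).
- move=> [x y]; rewrite indicE.
  case: (boolP (_ \in G)) => /= [|_]; last by rewrite mul0r.
  by rewrite inE mul1r /= => /GJ[-> /J0].
- move=> x y; rewrite !indicE GCE.
  case: (boolP (_ \in G)) => /= [|_]; last by rewrite !mul0r.
  rewrite inE !mul1r /= => yx; have [-> yx0] := GJ _ _ yx.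
  have [-> _] := GJ _ _ (GC _ _ yx).
  by rewrite -opprB Jeven// subr_eq0 -subr_eq0.
- move=> x y Hx Hy; rewrite !indicE GQE.
  case: (boolP (_ \in G)) => /= [|_]; last by rewrite !mul0r.
  rewrite inE !mul1r /= => xy; have [-> xy0] := GJ _ _ xy.
  by have [-> _] := GJ _ _ (GQ _ _ xy); apply: Jhalf => //; rewrite -subr_eq0.
- move=> x.
  have ae0 z : {ae mu, forall y, G0 (z, y)}.
    apply: filterS2 (preserves_ae (preserves_subl z) aeZ)
      (preserves_ae (preserves_addr (- z)) aeZ) => y h1 h2; split => //.
  have aeG : {ae mu, forall y, (G0 (x, y) /\ G0 (x, Q y)) /\
      (G0 (Q x, y) /\ G0 (Q x, Q y))}.
    apply: filterI; apply: filterI; try exact: ae0;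
      exact: (preserves_ae pQ (ae0 _)).
  apply: filterS aeG => y [[h1 h2] [h3 h4]].
  have Gxy : G (x, y) by split.
  by rewrite indicE mem_set// mul1r /=; have [] := GJ _ _ Gxy.
Qed.

(** Correct a Borel version of [v] to be nonnegative on [H \ U], restrict it to
    [H], and extend it by odd reflection: r(x) - r(Qx). *)
Lemma antisymmetric_representative e b (U : set 'rV[R]_n) (v : 'rV[R]_n -> R) :
  e != 0 -> measurable U -> U `<=` half_space e b -> lebesgue_measurable v ->
  {ae mu, forall x, v (reflection e b x) = - v x} ->
  {ae mu, forall x, (half_space e b `\` U) x -> 0 <= v x} ->
  exists v' : 'rV[R]_n -> R,
    [/\ measurable_fun setT v', {ae mu, forall x, v x = v' x},
        forall x, v' (reflection e b x) = - v' x &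
        forall x, half_space e b x -> ~ U x -> 0 <= v' x].
Proof.
move=> e0 mU UH [g mg vg] vQ v0.
have mH := @measurable_half_space e b.
have QQ := @reflectionK _ _ e b e0.
have pQ : preserves mu _ := @preserves_reflection _ _ e b e0.
have HQ := fun x => @half_space_reflectionN e b x e0.
have HQT := fun x => @half_space_cases e b x e0.
move: mH QQ pQ HQ HQT vQ v0 UH.
set Q := reflection e b; set H := half_space e b => mH QQ pQ HQ HQT vQ v0 UH.
pose r x := \1_U x * g x + \1_(H `\` U) x * Num.max (g x) 0.
have rN x : ~ H x -> r x = 0.
  move=> Hx; rewrite /r !indicE !memNset ?mul0r ?addr0//; first by case.
  by move/UH.
have mr : measurable_fun setT r.
  apply: measurable_funD; apply: measurable_funM => //.
    exact/measurable_indic/measurableD.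
  exact: measurable_maxr.
exists (fun x => r x - r (Q x)); split.
- by apply: measurable_funB => //; exact: (measurableT_comp mr pQ.1).
- have good : {ae mu, forall x, v x = g x /\ ((H `\` U) x -> 0 <= v x)}.
    exact: filterI vg v0.
  have rv x : v x = g x /\ ((H `\` U) x -> 0 <= v x) -> H x -> r x = v x.
    move=> [vgx vx0] Hx; rewrite /r !indicE; have [Ux|Ux] := pselect (U x).
      rewrite mem_set// memNset; last by case.
      by rewrite mul1r mul0r addr0.
    rewrite memNset// mem_set// mul0r mul1r add0r -vgx max_l//.
    exact: vx0.
  apply: filterS3 good (preserves_ae pQ good) vQ => x gx gQx vQx.
  case: (HQT x) => [Hx|HQx|Qx].
  + by rewrite (rN (Q x)) ?subr0 ?rv//; exact: HQ.
  + rewrite (rN x) ?sub0r ?rv// ?vQx ?opprK//.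
    by move=> Hx; exact: HQ Hx _.
  + rewrite Qx subrr; move: vQx; rewrite Qx; lra.
- by move=> x; rewrite QQ opprB.
- move=> x Hx Ux; rewrite (rN (Q x)) ?subr0; last exact: HQ.
  rewrite /r !indicE memNset// mem_set// mul0r mul1r add0r.
  by rewrite le_max lexx orbT.
Qed.

End borel_representatives.

(** * Energies as absolutely convergent double integrals *)

Section nonlocal_energy.
Context {R : realType} {n : nat}.
Notation mu := (@lebesgue_rV R n).
Notation mm := (mu \x mu)%E.
Implicit Types (e x y z : 'rV[R]_n) (b : R) (J : 'rV[R]_n -> R).

(** Where |z| >= r, J is at most its part on |z| >= 1 plus r^-2 |z|^2 J on
    |z| < 1. *)
Lemma kernel_tail_lty J (r : R) : (0 < n)%N -> 0 < r ->
  (forall z, z != 0 -> 0 <= J z) -> lebesgue_measurable J ->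
  (\int[mu]_(z in [set z | (1 <= enorm z)%R]) (J z)%:E +
   \int[mu]_(z in [set z | (enorm z < 1)%R]) (enorm z ^+ 2 * J z)%:E < +oo)%E ->
  (\int[mu]_(z in [set z | (r <= enorm z)%R]) (J z)%:E < +oo)%E.
Proof.
move=> n0 r0 J0 [g mg Jg].
pose h z := Num.max (g z) 0.
have mh : measurable_fun setT h by exact: measurable_maxr.
have h0 z : 0 <= h z by rewrite le_max lexx orbT.
have Jh : {ae mu, forall z, J z = h z}.
  apply: filterS2 Jg (ae_neq0 n0) => z Jz /J0 Jz0.
  by rewrite /h -Jz max_l.
have mE := @measurable_enorm R n.
have mge := @measurable_enorm_ge R n.
have mlt : measurable [set z : 'rV[R]_n | enorm z < 1].
  rewrite (_ : [set _ | _] = ~` [set z | 1 <= enorm z]).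
    by apply: measurableC; exact: mge.
  by apply/seteqP; split => z /=; rewrite ltNge => /negP.
rewrite (ae_integral_congr (D := [set z | 1 <= enorm z])
  (g := fun z => (h z)%:E)); last first.
  by apply: filterS Jh => z ->.
rewrite (ae_integral_congr (D := [set z | enorm z < 1])
  (g := fun z => (enorm z ^+ 2 * h z)%:E)); last first.
  by apply: filterS Jh => z ->.
rewrite (ae_integral_congr (D := [set z | r <= enorm z])
  (g := fun z => (h z)%:E)); last first.
  by apply: filterS Jh => z ->.
rewrite (integral_indicl _ [set z | 1 <= enorm z]).
rewrite (integral_indicl _ [set z | r <= enorm z]).
rewrite (integral_indicl _ [set z | enorm z < 1]).
set h1 := fun z => \1_[set z | 1 <= enorm z] z * h z.
set h2 := fun z => \1_[set z | enorm z < 1] z * (enorm z ^+ 2 * h z).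
have h10 z : 0 <= h1 z by rewrite mulr_ge0// indicE.
have h20 z : 0 <= h2 z.
  by apply: mulr_ge0; [rewrite indicE|apply: mulr_ge0 => //; exact: sqr_ge0].
have mh1 : measurable_fun setT h1 by exact: measurable_funM.
have mh2 : measurable_fun setT h2.
  by apply: measurable_funM => //; apply: measurable_funM => //;
    exact: measurable_funX.
move=> h12.
have I1 : (0 <= \int[mu]_z (h1 z)%:E)%E.
  by apply: integral_ge0 => z _; rewrite lee_fin.
have I2 : (0 <= \int[mu]_z (h2 z)%:E)%E.
  by apply: integral_ge0 => z _; rewrite lee_fin.
have i1 : (\int[mu]_z (h1 z)%:E < +oo)%E.
  by apply: le_lt_trans h12; exact: leeDl.
have i2 : (\int[mu]_z (h2 z)%:E < +oo)%E.
  by apply: le_lt_trans h12; exact: leeDr.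
have r20 : 0 <= r ^- 2 by rewrite invr_ge0 exprn_ge0// ltW.
apply: (@le_lt_trans _ _ (\int[mu]_z ((h1 z)%:E + (r ^- 2)%:E * (h2 z)%:E))%E).
  apply: ge0_le_integral => //.
  - by move=> z _; rewrite lee_fin mulr_ge0// indicE.
  - apply/measurable_EFinP/measurable_funM => //; exact: measurable_indic.
  - apply: emeasurable_funD; first exact/measurable_EFinP.
    by apply/measurable_EFinP/measurable_funM.
  move=> z _; rewrite lee_fin indicE.
  have [rz|rz] := boolP (z \in [set z | r <= enorm z]); last first.
    by rewrite mul0r; apply: addr_ge0 => //; exact: mulr_ge0.
  move: rz; rewrite inE /= => rz; rewrite mul1r /h1 /h2 !indicE.
  have [z1|z1] := leP 1 (enorm z).
    rewrite mem_set// mul1r lerDl memNset ?mul0r ?mulr0//=.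
    by apply/negP; rewrite -leNgt.
  rewrite memNset/=; last by apply/negP; rewrite -ltNge.
  rewrite mem_set// mul0r add0r mul1r mulrA ler_peMl//.
  rewrite mulrC ler_pdivlMr ?exprn_gt0// mul1r.
  by rewrite lerXn2r// nnegrE ltW// (lt_le_trans r0).
rewrite ge0_integralD//; last 4 first.
- by move=> z _; rewrite lee_fin.
- exact/measurable_EFinP.
- by move=> z _; rewrite lee_fin; exact: mulr_ge0.
- by apply/measurable_EFinP/measurable_funM.
apply: lte_add_pinfty => //; rewrite ge0_integralZl_EFin//.
- by rewrite lte_mul_pinfty.
- by move=> z _; rewrite lee_fin.
- exact/measurable_EFinP.
Qed.

Variables (J : 'rV[R]_n -> R) (K : 'rV[R]_n * 'rV[R]_n -> R).
Hypotheses (mK : measurable_fun setT K) (K0 : forall p, 0 <= K p).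
Hypothesis KJ : forall x, {ae mu, forall y, K (x, y) = J (x - y)}.

Lemma energyE (u u' w w' : 'rV[R]_n -> R) : {ae mu, forall x, u x = u' x} ->
  {ae mu, forall x, w x = w' x} ->
  let F p := (u' p.1 - u' p.2) * (w' p.1 - w' p.2) * K p in
  mm.-integrable setT (EFin \o F) ->
  energy J u w = ((2^-1)%:E * \int[mm]_p (F p)%:E)%E.
Proof.
move=> uu ww F iF; rewrite /energy; congr (_ * _)%E.
rewrite -(integral12_prod_meas1 (f := EFin \o F))//.
apply: ae_integral_congr.
have [aeu aew] := (uu, ww).
apply: filterS2 aeu aew => x ux wx _; apply: ae_integral_congr.
apply: filterS3 uu ww (KJ x) => y uy wy Kxy _.
by rewrite /F /= ux uy wx wy Kxy.
Qed.

Lemma integrable_near (U' : set 'rV[R]_n) (v v' : 'rV[R]_n -> R) :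
  measurable U' ->
  measurable_fun setT v' -> {ae mu, forall x, v x = v' x} -> H_space J U' v ->
  mm.-integrable setT (EFin \o
    (fun p => \1_U' p.1 * (\1_U' p.2 * ((v' p.1 - v' p.2) ^+ 2 * K p)))).
Proof.
move=> mU' mv' vv' [_ Hv].
have mvi (f : 'rV[R]_n -> R) : measurable_fun setT f ->
    measurable_fun setT (fun p : 'rV[R]_n * 'rV[R]_n => f p.1).
  by move=> mf; exact: (measurableT_comp mf measurable_fst).
have mvj (f : 'rV[R]_n -> R) : measurable_fun setT f ->
    measurable_fun setT (fun p : 'rV[R]_n * 'rV[R]_n => f p.2).
  by move=> mf; exact: (measurableT_comp mf measurable_snd).
have mF : measurable_fun setT
    (fun p => \1_U' p.1 * (\1_U' p.2 * ((v' p.1 - v' p.2) ^+ 2 * K p))).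
  apply: measurable_funM; first exact: (mvi _ (measurable_indic mU')).
  apply: measurable_funM; first exact: (mvj _ (measurable_indic mU')).
  apply: measurable_funM => //; apply: measurable_funX.
  by apply: measurable_funB; [exact: mvi|exact: mvj].
apply/integrable12ltyP; first exact/measurable_EFinP.
apply: le_lt_trans Hv; rewrite le_eqVlt; apply/orP; left; apply/eqP.
under eq_integral.
  move=> x _; under eq_integral.
    move=> y _ /=; rewrite ger0_norm; last first.
      apply: mulr_ge0; first by rewrite indicE.
      apply: mulr_ge0; first by rewrite indicE.
      by apply: mulr_ge0 => //; exact: sqr_ge0.
    over.
  over.
transitivity (\int[mu]_(x in U')
   \int[mu]_(y in U') ((v' x - v' y) ^+ 2 * K (x, y))%:E)%E.
  rewrite [RHS]integral_mkcond; apply: eq_integral => x _ /=.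
  rewrite patchE (integral_indicl _ U'); case: (boolP (x \in U')) => xU'.
    by apply: eq_integral => y _; rewrite indicE xU' mul1r.
  by rewrite integral0_eq// => y _; rewrite indicE (negbTE xU') mul0r.
have aev := vv'; apply: ae_integral_congr; apply: filterS aev => x vx _.
apply: ae_integral_congr; apply: filterS2 vv' (KJ x) => y vy -> _.
by rewrite vx vy.
Qed.

(** Integrating in y first leaves the tail integral of J, the same constant for
    every x, times v(x)^2. *)
Lemma integrable_far (r : R) (v v' : 'rV[R]_n -> R) :
  (forall z, z != 0 -> 0 <= J z) ->
  (0 < n)%N -> lebesgue_measurable J ->
  (\int[mu]_(z in [set z | (r <= enorm z)%R]) (J z)%:E < +oo)%E ->
  measurable_fun setT v' -> {ae mu, forall x, v x = v' x} -> L2_space v ->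
  mm.-integrable setT (EFin \o
    (fun p : 'rV[R]_n * 'rV[R]_n =>
      v' p.1 ^+ 2 * (\1_[set z | r <= enorm z] (p.1 - p.2) * K p))).
Proof.
move=> J0 n0 [g mg Jg] tail mv' vv' [_ L2v].
have mge := @measurable_enorm_ge R n r.
set far := [set z | _].
pose h z := \1_far z * Num.max (g z) 0.
have mh : measurable_fun setT h.
  by apply: measurable_funM; [exact: measurable_indic|exact: measurable_maxr].
have h0 z : 0 <= h z by rewrite mulr_ge0// ?indicE// le_max lexx orbT.
have Jh : {ae mu, forall z, \1_far z * J z = h z}.
  apply: filterS2 Jg (ae_neq0 n0) => z Jz /J0 Jz0.
  by rewrite /h -Jz max_l.
set F := fun p => v' p.1 ^+ 2 * _.
have mD : measurable_fun setT F.
  apply: measurable_funM.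
    by apply: measurable_funX; exact: (measurableT_comp mv' measurable_fst).
  apply: measurable_funM => //.
  apply: (measurableT_comp _ measurable_rV_sub); exact: measurable_indic.
apply/integrable12ltyP; first exact/measurable_EFinP.
have inner x : (\int[mu]_y `|(EFin \o F) (x, y)| =
    (v' x ^+ 2)%:E * \int[mu]_z (h z)%:E)%E.
  rewrite -(preserves_ge0_integral (F := fun z => (h z)%:E)
    (preserves_subl x))//; last exact/measurable_EFinP.
  rewrite -ge0_integralZl_EFin//; last 3 first.
  - by move=> y _; rewrite lee_fin.
  - apply/measurable_EFinP; apply: (measurableT_comp mh).
    exact: (preserves_subl x).1.
  - exact: sqr_ge0.
  apply: ae_integral_congr.
  apply: filterS2 (KJ x) (preserves_ae (preserves_subl x) Jh) => y Kxy Jhy _ /=.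
  rewrite -EFinM -Jhy -Kxy ger0_norm//.
  apply: mulr_ge0; first exact: sqr_ge0.
  by apply: mulr_ge0 => //; rewrite indicE.
under eq_integral do rewrite inner.
rewrite ge0_integralZr//; last 3 first.
- by apply/measurable_EFinP; exact: measurable_funX.
- by move=> x _; rewrite lee_fin sqr_ge0.
- by apply: integral_ge0 => z _; rewrite lee_fin.
apply: lte_mul_pinfty.
- by apply: integral_ge0 => z _; rewrite lee_fin sqr_ge0.
- rewrite ge0_fin_numE; last first.
    by apply: integral_ge0 => z _; rewrite lee_fin sqr_ge0.
  rewrite (ae_integral_congr (g := fun x => (v x ^+ 2)%:E))//.
  by apply: filterS vv' => x ->.
- rewrite (ae_integral_congr (g := fun z => (\1_far z * J z)%:E)); last first.
    by apply: filterS Jh => z ->.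
  by rewrite -(integral_indicl _ far).
Qed.

End nonlocal_energy.

(** * The potential term and the eigenvalue comparison *)

Section potential.
Context {R : realType} {n : nat}.
Notation mu := (@lebesgue_rV R n).
Implicit Types (U : set 'rV[R]_n) (c v phi : 'rV[R]_n -> R).

Lemma Linfty_norm_ae U c : (0 < mu setT)%E ->
  {ae mu, forall x, U x -> (`|c x|%:E <= Linfty_norm U c)%E}.
Proof.
move=> mu0; have := ess_sup_ge mu (abse \o (EFin \o (c \_ U))).
apply: filterS => x /= cx Ux.
by move: cx; rewrite patchE mem_set// /Linfty_norm unlock /Lnorm mu0.
Qed.

(** With v phi = - phi^2 the left side of the supersolution inequality becomes
    the integral of - c phi^2, and c is at most its positive part. *)
Lemma potential_lower_bound U c v phi (M : R) : (0 < mu setT)%E ->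
  Linfty_space U c -> (Linfty_norm U (c^\+)%R <= M%:E)%E ->
  measurable_fun setT phi -> (\int[mu]_x (phi x ^+ 2)%:E < +oo)%E ->
  (forall x, ~ U x -> phi x = 0) ->
  {ae mu, forall x, v x * phi x = - phi x ^+ 2} ->
  (- (M%:E * \int[mu]_x (phi x ^+ 2)%:E) <=
     \int[mu]_(x in U) (c x * v x * phi x)%:E)%E.
Proof.
move=> mu0 [[g mg cg] cfin] cM mphi phi2 phiU vphi.
have L0 : (0 <= Linfty_norm U c)%E by exact: Lnorm_ge0.
have [L LE] : exists L : R, Linfty_norm U c = L%:E.
  by exists (fine (Linfty_norm U c)); rewrite fineK// ge0_fin_numE.
have M0 : 0 <= M by rewrite -lee_fin (le_trans _ cM)// Lnorm_ge0.
move: L0; rewrite LE lee_fin => L0.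
(* Truncation makes the bounds on the Borel version of c hold everywhere. *)
pose c1 x := Num.max (- L) (Num.min M (g x)).
have mc1 : measurable_fun setT c1.
  by apply: measurable_maxr => //; exact: measurable_minr.
have c1M x : c1 x <= M.
  by rewrite ge_max ge_min lexx andbT (le_trans _ M0)// oppr_le0.
have c1L x : - L <= c1 x by rewrite le_max lexx.
have cc1 : {ae mu, forall x, U x -> c x = c1 x}.
  have cL := Linfty_norm_ae U c mu0; have cpM := Linfty_norm_ae U (c^\+)%R mu0.
  apply: filterS3 cg cL cpM => x cgx cLx cpMx Ux.
  have cx : c x = g x by rewrite -cgx patchE mem_set.
  have := cLx Ux; rewrite LE lee_fin ler_norml => /andP[cl _].
  have := le_trans (cpMx Ux) cM; rewrite lee_fin ger0_norm ?funrpos_ge0// => cm.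
  have {}cm : c x <= M by apply: le_trans cm; rewrite /funrpos le_max lexx.
  by rewrite /c1 -cx (min_r cm) max_r.
have iphi2 : mu.-integrable setT (EFin \o (fun x => phi x ^+ 2)).
  apply/integrableP; split.
    by apply/measurable_EFinP; exact: measurable_funX.
  rewrite (eq_integral (fun x => (phi x ^+ 2)%:E))// => x _ /=.
  by rewrite ger0_norm ?sqr_ge0.
have ic : mu.-integrable setT (EFin \o (fun x => - (c1 x * phi x ^+ 2))).
  apply: (le_integrable _ _ _ (integrableZl _ (L + M) iphi2)) => //.
    apply/measurable_EFinP/measurable_funN/measurable_funM => //.
    exact: measurable_funX.
  move=> x _ /=; rewrite lee_fin normrN !normrM ler_wpM2r//.
  rewrite (ger0_norm (addr_ge0 L0 M0)) ler_norml.
  by have := c1M x; have := c1L x; lra.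
have -> : (\int[mu]_(x in U) (c x * v x * phi x)%:E =
    \int[mu]_x (- (c1 x * phi x ^+ 2))%:E)%E.
  rewrite (ae_integral_congr
    (g := fun x => (- (c1 x * phi x ^+ 2))%:E)); last first.
    by apply: filterS2 cc1 vphi => x cx vx Ux; rewrite -mulrA vx cx// mulrN.
  rewrite (integral_indicl _ U); apply: eq_integral => x _.
  rewrite indicE; have [Ux|Ux] := pselect (U x).
    by rewrite mem_set// mul1r.
  by rewrite memNset// mul0r phiU// expr0n mulr0 oppr0.
rewrite -mulNe -EFinN -(integralZl measurableT iphi2).
apply: le_integral => //; first exact: integrableZl.
by move=> x _ /=; rewrite lee_fin mulNr lerN2 ler_wpM2r// sqr_ge0.
Qed.

End potential.

Theorem proposition3p5 (R : realType) (N : nat)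
  (e : 'rV[R]_N) (b : R) (e_neq0 : e != 0)
  (J : 'rV[R]_N -> R)
  (J_ge0 : forall z : 'rV[R]_N, z != 0 -> 0 <= J z)
  (J_meas : lebesgue_measurable J)
  (J_even : forall z : 'rV[R]_N, z != 0 -> J (- z) = J z)
  (J1_fin : (\int[lebesgue_rV N]_(z in [set z | (1 <= enorm z)%R]) (J z)%:E +
             \int[lebesgue_rV N]_(z in [set z | (enorm z < 1)%R])
                (enorm z ^+ 2 * J z)%:E < +oo)%E)
  (J1_inf : (\int[lebesgue_rV N]_z (J z)%:E = +oo)%E)
  (J_refl : forall x y : 'rV[R]_N, x != y ->
     J (reflection e b x - reflection e b y) = J (x - y))
  (J_half : forall x y : 'rV[R]_N, half_space e b x -> half_space e b y -> x != y ->
     J (x - reflection e b y) <= J (x - y))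
  (U : set 'rV[R]_N) (U_sub : U `<=` half_space e b)
  (U_open : open U) (U_bounded : bounded_set U)
  (c : 'rV[R]_N -> R) (c_Linfty : Linfty_space U c)
  (c_lt : (Linfty_norm U (c^\+)%R < Lambda1 J U)%E)
  (v : 'rV[R]_N -> R)
  (v_super : antisymmetric_supersolution J e b U c v) :
  {ae lebesgue_rV N, forall x, half_space e b x -> 0 <= v x}.
Proof.
have [vQ [U' [oU' bU' QU' UU' Hv]] v_ge0 vsup] := v_super.
have N0 := dim_gt0 e_neq0.
have mU := measurable_open_rV U_open; have mU' := measurable_open_rV oU'.
have [L2v _] := Hv; have [mvL v2] := L2v.
have [v' [mv' vv' vQ' v'_ge0]] :=
  antisymmetric_representative e_neq0 mU U_sub mvL vQ v_ge0.
have [K [mK K0 Ksym Khalf KJ]] :=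
  reflected_kernel e_neq0 J_ge0 J_meas J_even J_half.
have sUU' : U `<=` U' by apply: subset_trans UU'; exact: subset_closure.
have [r r0 margin] : exists2 r, 0 < r &
    forall x y, closure U x -> ~ U' y -> r <= enorm (x - y).
  apply: compact_open_margin => //; apply: bounded_closed_compact => //.
    have [B [Breal hB]] := bU'.
    by exists B; split => // y By x /UU'; exact: hB.
  exact: closed_closure.
have tail := kernel_tail_lty N0 r0 J_ge0 J_meas J1_fin.
set Q := reflection e b.
have QU'' x : U' x -> U' (Q x) by move=> U'x; rewrite -QU'; exists x.
pose E (p : 'rV[R]_N * 'rV[R]_N) :=
  \1_U' p.1 * (\1_U' p.2 * ((v' p.1 - v' p.2) ^+ 2 * K p)).
pose D (p : 'rV[R]_N * 'rV[R]_N) :=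
  v' p.1 ^+ 2 * (\1_[set z | r <= enorm z] (p.1 - p.2) * K p).
have E0 p : 0 <= E p.
  apply: mulr_ge0; first by rewrite indicE.
  apply: mulr_ge0; first by rewrite indicE.
  by apply: mulr_ge0 => //; exact: sqr_ge0.
have D0 p : 0 <= D p.
  apply: mulr_ge0; first exact: sqr_ge0.
  by apply: mulr_ge0 => //; rewrite indicE.
have vE x y : U' x -> U' y -> (v' x - v' y) ^+ 2 * K (x, y) <= E (x, y).
  by move=> U'x U'y; rewrite /E /= !indicE !mem_set// !mul1r.
have vD x y : U x /\ ~ U' y \/ ~ U' x /\ U y ->
    v' x ^+ 2 * K (x, y) <= D (x, y).
  move=> xy; rewrite /D /= indicE mem_set ?mul1r//=.
  case: xy => [[Ux U'y]|[U'x Uy]].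
    by apply: margin => //; exact: subset_closure.
  by rewrite enorm_subC; apply: margin => //; exact: subset_closure.
have [iP iA AP] := energy_cross_negpart (preserves_reflection b e_neq0)
  (reflectionK b e_neq0) (fun x => @half_space_reflectionN _ _ e b x e_neq0)
  (fun x => @half_space_cases _ _ e b x e_neq0) mU U_sub sUU'
  QU'' mK K0 Ksym Khalf mv' vQ' v'_ge0 E0 D0
  (integrable_near mK K0 KJ mU' mv' vv' Hv)
  (integrable_far mK K0 KJ J_ge0 N0 J_meas tail mv' vv' L2v) vE vD.
set phi := negpart_on U v' in iP iA AP.
have mphi : measurable_fun setT phi by exact: measurable_negpart_on.
have phi_ge0 x : 0 <= phi x by exact: negpart_on_ge0.
have phiU x : ~ U x -> phi x = 0 by exact: negpart_on_out.
have aephi : {ae lebesgue_rV N, forall x, phi x = phi x} by exact: nearW.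
move: AP; set IA := integral _ _ _; set IP := integral _ _ _ => AP.
have ephi : energy J phi phi = ((2^-1)%:E * IP)%E := energyE KJ aephi aephi iP.
have ecross : energy J v phi = ((2^-1)%:E * IA)%E := energyE KJ vv' aephi iA.
have [p IPE] : exists p : R, IP = p%:E.
  exists (fine IP); rewrite fineK//.
  exact: (integrable_fin_num measurableT iP).
have Dphi : D_space J U phi.
  split; [by exists phi| by rewrite ephi IPE -EFinM ltry |].
  by apply: nearW => x; exact: phiU.
have phi2 : (\int[lebesgue_rV N]_x (phi x ^+ 2)%:E < +oo)%E.
  apply: le_lt_trans v2.
  rewrite (ae_integral_congr (f := fun x => (v x ^+ 2)%:E)
    (g := fun x => (v' x ^+ 2)%:E)); last by apply: filterS vv' => x ->.
  apply: ge0_le_integral => //.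
  - by move=> x _; rewrite lee_fin sqr_ge0.
  - by apply/measurable_EFinP; exact: measurable_funX.
  - by apply/measurable_EFinP; exact: measurable_funX.
  move=> x _; rewrite lee_fin /phi /negpart_on.
  case: (x \in U); last by rewrite expr0n sqr_ge0.
  by case: (ltP (- v' x) 0) => _; rewrite ?sqrrN ?expr0n ?sqr_ge0.
have vphi : {ae lebesgue_rV N, forall x, v x * phi x = - phi x ^+ 2}.
  apply: filterS vv' => x ->; rewrite /phi /negpart_on.
  case: (x \in U); last by rewrite mulr0 expr0n oppr0.
  case: (ltP (- v' x) 0) => _; first by rewrite mulr0 expr0n oppr0.
  by rewrite sqrrN mulrN expr2.
have v'E x : half_space e b x -> phi x = 0 -> 0 <= v' x.
  move=> Hx; have [Ux|Ux] := pselect (U x); last by move=> _; exact: v'_ge0.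
  rewrite /phi negpart_on_in//; case: (ltP (- v' x) 0); lra.
suff phi_ae0 : {ae lebesgue_rV N, forall x, phi x = 0}.
  by apply: filterS2 vv' phi_ae0 => x -> phix0 Hx; exact: v'E.
(* The L^infty norm over a space of measure 0 is 0 by convention and does not
   bound c; the claim is then void. *)
have [mu0|mu0] := pselect (0 < lebesgue_rV N [set: 'rV[R]_N])%E; last first.
  exists setT; split => //; apply/eqP; rewrite eq_le measure_ge0 andbT leNgt.
  exact/negP.
apply: contrapT => phi_neq0.
have M0 : (0 <= Linfty_norm U (c^\+)%R)%E by exact: Lnorm_ge0.
have [M ME] : exists M : R, Linfty_norm U (c^\+)%R = M%:E.
  exists (fine (Linfty_norm U (c^\+)%R)); rewrite fineK// ge0_fin_numE//.
  by apply: lt_le_trans c_lt _; rewrite leey.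
have s0 : (0 <= \int[lebesgue_rV N]_x (phi x ^+ 2)%:E)%E.
  by apply: integral_ge0 => x _; rewrite lee_fin sqr_ge0.
have [s sE] : exists s : R, (\int[lebesgue_rV N]_x (phi x ^+ 2)%:E = s%:E)%E.
  exists (fine (\int[lebesgue_rV N]_x (phi x ^+ 2)%:E)).
  by rewrite fineK// ge0_fin_numE.
have s_gt0 : 0 < s.
  move: s0; rewrite sE lee_fin le_eqVlt => /predU1P[s00|//]; exfalso.
  apply: phi_neq0.
  have : (\int[lebesgue_rV N]_x `|(phi x ^+ 2)%:E| = 0)%E.
    rewrite (eq_integral (fun x => (phi x ^+ 2)%:E)) ?sE -?s00// => x _ /=.
    by rewrite ger0_norm// sqr_ge0.
  have mphi2 : measurable_fun setT (EFin \o (fun x => phi x ^+ 2)).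
    by apply/measurable_EFinP; exact: measurable_funX.
  move/(ae_eq_integral_abs _ measurableT mphi2).
  by apply: filterS => x /(_ I) /= [] /eqP; rewrite sqrf_eq0 => /eqP.
have lower : (- (M * s)%:E <= energy J v phi)%E.
  apply: le_trans (vsup phi Dphi _); last exact: nearW.
  rewrite EFinM -sE; apply: potential_lower_bound => //.
  by rewrite ME.
have pMs : 2^-1 * p <= M * s.
  have := le_trans lower _; move/(_ (- (2^-1 * p)%:E)%E).
  rewrite leeN2 lee_fin; apply.
  rewrite ecross EFinM -IPE -muleN; apply: lee_wpmul2l AP.
  by rewrite lee_fin.
have : (Lambda1 J U <= M%:E)%E.
  apply: (@le_trans _ _ (energy J phi phi /
      \int[lebesgue_rV N]_(x in U) (phi x ^+ 2)%:E)%E).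
    by apply: ereal_inf_lbound; exists phi.
  have -> : (\int[lebesgue_rV N]_(x in U) (phi x ^+ 2)%:E = s%:E)%E.
    rewrite -sE (integral_indicl _ U); apply: eq_integral => x _.
    rewrite indicE; have [Ux|Ux] := pselect (U x).
      by rewrite mem_set// mul1r.
    by rewrite memNset// mul0r phiU// expr0n.
  rewrite ephi IPE inver gt_eqF// -!EFinM lee_fin.
  by rewrite ler_pdivrMr.
by rewrite -ME leNgt c_lt.
Qed.
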